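(* Let $D\in\mathbb{R}^{m\times n}$, let $S\in\mathcal{S}(D)$ be arbitrary and let $x,t>0$. Choose $\lambda\ge \gamma\sigma\sqrt{2\log(2(n-r_S))/n+2t/n}$. Then for the analysis estimator $\hat f$ with tuning parameter $\lambda$ it holds that, for all $f\in\mathbb{R}^n$, with probability at least $1-e^{-x}-e^{-t}$, $$\|\hat f-f^0\|_n^2\le \|f-f^0\|_n^2+4\lambda\|D_{-S}f\|_1+\left(\sigma\sqrt{\frac{2x}{n}}+\sigma\sqrt{\frac{r_S}{n}}+\frac{\lambda\sqrt{r_S}}{\kappa(S,W)}\right)^2 .$$
   Context: Model: $f^0\in\mathbb{R}^n$ is a fixed signal and one observes $Y=f^0+\epsilon$ with $\epsilon\sim\mathcal{N}_n(0,\sigma^2 \mathrm{I}_n)$, $\sigma\in(0,\infty)$. For $f\in\mathbb{R}^n$, $\|f\|_n^2=\sum_{i=1}^n f_i^2/n$. The analysis estimator is $\hat f=\arg\min_{f\in\mathbb{R}^n}\{\|Y-f\|_n^2+2\lambda\|Df\|_1\}$, $\lambda>0$. Active sets: $[m]=\{1,\dots,m\}$; $d_i'$ is the $i$-th row of $D$. For $S\subseteq[m]$, $-S=[m]\setminus S$, $s=|S|$, and $D_S$, $D_{-S}$ are the submatrices of $D$ with rows indexed by $S$, $-S$. Put $S(f)=\{j\in[m]: d_j'f\neq0\}$ and $\mathcal{S}(D)=\{S\subseteq[m]:\exists f\in\mathbb{R}^n,\ S=S(f)\}$. $r_S=\dim \mathcal{N}(D_{-S})$, the dimension of the nullspace of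 $D_{-S}$. Scaling factor and weights: let $D_{-S}^+\in\mathbb{R}^{n\times(m-s)}$ be the Moore–Penrose pseudoinverse of $D_{-S}$, with columns $d_1^+,\dots,d_{m-s}^+$; for $i\in-S$ let $i^*(i)=\sum_{j=1}^i 1_{\{j\in -S\}}$ be the row index in $D_{-S}$ of the $i$-th row of $D$. Define $\omega_i=\|d^+_{i^*(i)}\|_n$ for $i\in-S$, $\omega_i=0$ for $i\in S$, $\gamma=\max_{i\in-S}\omega_i$, $w_i=1-\omega_i/\gamma$ for $i\in[m]$, and $W=\mathrm{diag}(\{w_i\}_{i\in[m]})$, $W_{-S}=\mathrm{diag}(\{w_i\}_{i\in-S})$. Weighted weak compatibility constant: $\kappa^2(S,W)=r_S\min\{\|f\|_n^2: f\in\mathbb{R}^n,\ \|D_Sf\|_1-\|W_{-S}D_{-S}f\|_1=1\}$, and $\kappa(S,W)$ is its nonnegative square root. *)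

(* Defs.v *)
From HB Require Import structures.
From mathcomp Require Import all_boot all_order all_algebra.
From mathcomp Require Import all_classical all_reals all_analysis.

Set Implicit Arguments.
Unset Strict Implicit.
Unset Printing Implicit Defensive.

Import Order.TTheory GRing.Theory Num.Theory.

Local Open Scope ring_scope.
Local Open Scope classical_set_scope.

Definition sqnormn (R : realType) (n : nat) (f : 'cV[R]_n) : R :=
  (\sum_(i < n) f i 0 ^+ 2) / n%:R.

Definition normn (R : realType) (n : nat) (f : 'cV[R]_n) : R :=
  Num.sqrt (sqnormn f).

(* The norm carried by 'cV[R]_p in the library is the sup norm, not this one. *)
Definition norm1 (R : realType) (p : nat) (v : 'cV[R]_p) : R :=
  \sum_(i < p) `|v i 0|.

(* enum_val lists S in increasing order, so the rows keep their order. *)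
Definition rows_in (R : realType) (m n : nat) (D : 'M[R]_(m, n))
  (S : {set 'I_m}) : 'M[R]_(#|S|, n) := rowsub (fun k : 'I_#|S| => enum_val k) D.

Definition active_set (R : realType) (m n : nat) (D : 'M[R]_(m, n))
  (f : 'cV[R]_n) : {set 'I_m} := [set j | (row j D *m f) 0 0 != 0]%SET.

Definition active_sets (R : realType) (m n : nat) (D : 'M[R]_(m, n)) :
  set {set 'I_m} := [set S | exists f : 'cV[R]_n, S = active_set D f].

(* kermx is a left kernel, hence the transpose: its row space is
   {f^T | rows_in D (~: S) *m f = 0}. *)
Definition null_dim (R : realType) (m n : nat) (D : 'M[R]_(m, n))
  (S : {set 'I_m}) : nat := \rank (kermx (rows_in D (~: S))^T).

(* The library's pinvmx satisfies only the first of these equations. *)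
Definition penrose (R : realType) (p n : nat) (A : 'M[R]_(p, n)) :
  set 'M[R]_(n, p) :=
  [set X | [/\ A *m X *m A = A, X *m A *m X = X,
               (A *m X)^T = A *m X & (X *m A)^T = X *m A]].

Definition mp_inv (R : realType) (p n : nat) (A : 'M[R]_(p, n)) :
  'M[R]_(n, p) := xget 0 (penrose A).

Lemma mulmx_trmx_eq0 (R : realType) (p n : nat) (B : 'M[R]_(p, n)) :
  B *m B^T = 0 -> B = 0.
Proof.
move=> B0; apply/matrixP => i j; rewrite mxE.
have /eqP := congr1 (fun M : 'M[R]_p => M i i) B0; rewrite !mxE.
rewrite psumr_eq0 => [|k _]; last by rewrite mxE -expr2 sqr_ge0.
by move/allP/(_ j (mem_index_enum j)); rewrite mxE -expr2 sqrf_eq0 => /eqP.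
Qed.

Lemma gram_unitmx (R : realType) (p n : nat) (B : 'M[R]_(p, n)) :
  row_free B -> B *m B^T \in unitmx.
Proof.
move=> Bfree; rewrite -row_free_unit -kermx_eq0; apply/eqP.
set K := kermx _; apply: (row_free_inj Bfree); rewrite mul0mx.
apply: mulmx_trmx_eq0; rewrite trmx_mul mulmxA -[K *m B *m _]mulmxA.
by rewrite mulmx_ker mul0mx.
Qed.

Lemma penrose_mulmx (R : realType) (p r n : nat) (V : 'M[R]_(p, r))
  (U : 'M[R]_(r, n)) : row_free V^T -> row_free U ->
  penrose (V *m U) (U^T *m invmx (U *m U^T) *m invmx (V^T *m V) *m V^T).
Proof.
move=> /gram_unitmx; rewrite trmxK => uV /gram_unitmx uU.
have sU : (U *m U^T)^T = U *m U^T by rewrite trmx_mul trmxK.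
have sV : (V^T *m V)^T = V^T *m V by rewrite trmx_mul trmxK.
set X := U^T *m _ *m _ *m _.
have eAX : V *m U *m X = V *m invmx (V^T *m V) *m V^T.
  rewrite /X !mulmxA -[V *m U *m U^T]mulmxA -[V *m _ *m invmx (U *m _)]mulmxA.
  by rewrite mulmxV// mulmx1.
have eXA : X *m (V *m U) = U^T *m invmx (U *m U^T) *m U.
  rewrite /X !mulmxA -[_ *m V^T *m V]mulmxA.
  by rewrite -[_ *m invmx (V^T *m V) *m _]mulmxA mulVmx// mulmx1.
split.
- rewrite eAX !mulmxA -[_ *m V^T *m V]mulmxA.
  by rewrite -[_ *m invmx (V^T *m V) *m _]mulmxA mulVmx// mulmx1.
- rewrite eXA /X !mulmxA -[_ *m U *m U^T]mulmxA.
  by rewrite -[_ *m invmx (U *m U^T) *m (U *m U^T)]mulmxA mulVmx// mulmx1.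
- by rewrite eAX !trmx_mul trmxK trmx_inv sV mulmxA.
- by rewrite eXA !trmx_mul trmxK trmx_inv sU mulmxA.
Qed.

Lemma penrose_mp_inv (R : realType) (p n : nat) (A : 'M[R]_(p, n)) :
  penrose A (mp_inv A).
Proof.
apply: (@xgetPex _ _ (penrose A)); rewrite -[X in penrose X]mulmx_base.
eexists; apply: penrose_mulmx; last exact: row_base_free.
by rewrite /row_free mxrank_tr; exact: col_base_full.
Qed.

Lemma penrose_unique (R : realType) (p n : nat) (A : 'M[R]_(p, n))
  (X Y : 'M[R]_(n, p)) : penrose A X -> penrose A Y -> X = Y.
Proof.
move=> [a1 a2 a3 a4] [b1 b2 b3 b4].
have eX : A *m X = A *m Y.
  by rewrite -{1}b1 -mulmxA -b3 -a3 -trmx_mul mulmxA a1 b3.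
have eY : X *m A = Y *m A.
  by rewrite -{1}b1 !mulmxA -[X *m A *m Y *m A]mulmxA -a4 -b4 -trmx_mul
    -mulmxA [A *m (X *m A)]mulmxA a1 b4.
by rewrite -a2 -mulmxA eX mulmxA eY b2.
Qed.

(* enum_rank_in iS i is the index i^*(i) of the i-th row of D among the rows of
   rows_in D (~: S), counted from 0. *)
Definition omega (R : realType) (m n : nat) (D : 'M[R]_(m, n))
    (S : {set 'I_m}) (i : 'I_m) : R :=
  match boolP (i \in (~: S)%SET) with
  | AltTrue iS => normn (col (enum_rank_in iS i) (mp_inv (rows_in D (~: S))))
  | AltFalse _ => 0
  end.

(* The omega i are nonnegative, so 0 only matters when ~: S is empty. *)
Definition gamma (R : realType) (m n : nat) (D : 'M[R]_(m, n))
  (S : {set 'I_m}) : R := \big[Num.max/0]_(i in (~: S)%SET) omega D S i.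

(* gamma D S = 0 only if rows_in D (~: S) = 0 or ~: S is empty; the value 1
   given by x / 0 = 0 is then irrelevant, since the weights only enter through
   weights_in D S (~: S) *m rows_in D (~: S). *)
Definition weight (R : realType) (m n : nat) (D : 'M[R]_(m, n))
  (S : {set 'I_m}) (i : 'I_m) : R := 1 - omega D S i / gamma D S.

Definition weights_in (R : realType) (m n : nat) (D : 'M[R]_(m, n))
    (S U : {set 'I_m}) : 'M[R]_#|U| :=
  diag_mx (\row_(k < #|U|) weight D S (enum_val k)).

(* Extended-valued because the constraint set may be empty, in which case its
   minimum is +oo. For S in active_sets D this happens exactly when S is empty.
   Otherwise the constraint set is nonempty and closed and sqnormn is coercive,
   so the infimum is a minimum. *)
Definition sq_compat (R : realType) (m n : nat) (D : 'M[R]_(m, n))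
    (S : {set 'I_m}) : \bar R :=
  ((null_dim D S)%:R%:E *
   ereal_inf [set (sqnormn f)%:E | f in [set f : 'cV[R]_n |
     (norm1 (rows_in D S *m f) -
      norm1 (weights_in D S (~: S)%SET *m rows_in D (~: S)%SET *m f) = 1)%R]])%E.

(* When S is empty, sqrt(null_dim) / compat = 0 either way: compat = +oo if
   0 < null_dim, and 0 / 0 = 0 * +oo = 0 in \bar R if null_dim = 0. *)
Definition compat (R : realType) (m n : nat) (D : 'M[R]_(m, n))
  (S : {set 'I_m}) : \bar R := sqrte (sq_compat D S).

Definition analysis_objective (R : realType) (m n : nat) (D : 'M[R]_(m, n))
    (lambda : R) (y f : 'cV[R]_n) : R :=
  sqnormn (y - f) + 2 * lambda * norm1 (D *m f).

(* The objective is continuous, coercive and strictly convex when 0 < lambda,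
   so exactly one such fhat exists. *)
Definition analysis_estimator (R : realType) (m n : nat) (D : 'M[R]_(m, n))
    (lambda : R) (fhat : 'cV[R]_n -> 'cV[R]_n) : Prop :=
  forall y f : 'cV[R]_n,
    analysis_objective D lambda y (fhat y) <= analysis_objective D lambda y f.

Definition mutually_independent (d : measure_display) (T : measurableType d)
    (R : realType) (P : probability T R) (n : nat)
    (X : 'I_n -> {RV P >-> R}) : Prop :=
  forall (J : {set 'I_n}) (B : 'I_n -> set R),
    (forall i, measurable (B i)) ->
    P [set w | forall i, i \in J -> B i (X i w)] =
    (\prod_(i in J) P (X i @^-1` B i))%E.

(* The law N_n(0, sigma^2 I_n). The second parameter of normal_prob is the
   standard deviation. *)
Definition isotropic_gaussian (d : measure_display) (T : measurableType d)
    (R : realType) (P : probability T R) (n : nat) (sigma : R)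
    (eps : 'I_n -> {RV P >-> R}) : Prop :=
  (forall (i : 'I_n) (B : set R), measurable B ->
     distribution P (eps i) B = normal_prob 0 sigma B) /\
  mutually_independent eps.

Definition observation (d : measure_display) (T : measurableType d)
    (R : realType) (P : probability T R) (n : nat) (f0 : 'cV[R]_n)
    (eps : 'I_n -> {RV P >-> R}) (w : T) : 'cV[R]_n :=
  f0 + \col_(i < n) eps i w.

(* Main.v *)
Require Import Defs.
From HB Require Import structures.
From mathcomp Require Import all_boot all_order all_algebra.
From mathcomp Require Import all_classical all_reals all_analysis.
From mathcomp Require Import perm measurable_realfun ring lra.

(** Write A = D_{-S}, X = A^+, r = rank A = n - r_S, Pi = 1 - X A (the
    orthogonal projection onto the null space of A), h = fhat - f, and d_k for
    the columns of X.

    Deterministic part. The objective of fhat is a squared distance plus a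
    convex penalty, so comparing fhat with f gains an extra term ||h||_n^2
    ([analysis_estimator_strong]). Expanding the square leaves the noise term
    2 eps'h/n, which splits as eps'Pi h + eps'X A h. The first part is at most
    ||Pi eps|| ||h||. If the second one is at most
    n lambda sum_k (omega_k/gamma) |(A h)_k|, then it turns the penalty
    difference ||D_S h||_1 - ||A h||_1 into ||D_S h||_1 - ||W_{-S} A h||_1,
    which the compatibility constant bounds by a multiple of ||h||_n, and
    2 a ||h||_n - ||h||_n^2 <= a^2 ends the argument ([oracle_inequality]).

    Projected noise. The bound ||Pi eps|| < sigma (sqrt r_S + sqrt (2x)) fails
    with probability at most e^{-x}: a Chernoff bound, where the exponential
    moment of ||Pi eps||^2 is computed by splitting off one dimension of Pi at
    a time and writing exp(s u^2/2) as a Gaussian mixture of exponentials of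
    linear forms ([subgaussian_proj_mgf], [subgaussian_proj_tail]).

    Noise along the rows of A. The number of rows of A can be much larger than
    r, so a union bound over the |-S| Gaussian variables eps'd_k would give
    log (2|-S|) and not log (2r). Put q_k(h) = ||d_k|| |(A h)_k| and let x_k be
    the standardized variables eps'd_k / (sigma ||d_k||), so that
    |eps'X A h| <= sigma sum_k q_k(h) |x_k| is a weighted average of the |x_k|,
    up to the factor sum_k q_k(h). The weight of index k in this average never
    exceeds some l_k, whatever h is, and the l_k can be chosen with a sum as
    close to r as desired ([l1_sensitivity]). Indeed, in a basis y_1, ..., y_r
    of unit vectors for the norm sum_k q_k(h) whose coordinate functionals have
    norm 1 (an Auerbach basis, obtained by maximizing a determinant), one can
    take l_k = sum_j q_k(y_j), which sums to r. By convexity of cosh, the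
    weighted average exceeds tau only if
    sum_k l_k cosh(tau x_k) > cosh(tau^2) ([cosh_jensen]), and by Markov's
    inequality this has probability at most
    r e^{tau^2/2} / cosh(tau^2) < 2 r e^{-tau^2/2}, which is e^{-t} when
    tau^2 = 2 log (2r) + 2t ([weighted_cosh_tail], [noise_event]). The strict
    inequality pays for the l_k summing to slightly more than r.

    The event of the theorem is measurable because fhat is 1-Lipschitz. *)

Set Implicit Arguments.
Unset Strict Implicit.
Unset Printing Implicit Defensive.

Import Order.TTheory GRing.Theory Num.Theory.
Import numFieldNormedType.Exports HBNNSimple.

Local Open Scope ring_scope.
Local Open Scope classical_set_scope.

(** * Integrals of weighted compositions *)

(** By monotone convergence along the simple functions approximating f, the
    integral of (f o X) Y is determined by its values on indicators f. *)
Lemma ge0_integral_comp_sfun d d' (T : measurableType d) (U : measurableType d')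
    (R : realType) (mu : {measure set T -> \bar R}) (X : T -> U) (Y : T -> R)
    (f : U -> R) (mf : measurable_fun setT (EFin \o f)) :
    measurable_fun setT X -> measurable_fun setT Y -> (forall w, 0 <= Y w) ->
    (forall u, 0 <= f u) ->
  let g := nnsfun_approx measurableT mf in
  (\int[mu]_w (f (X w) * Y w)%:E)%E =
  limn (fun k => \sum_(y \in range (g k))
    y%:E * \int[mu]_w (\1_(g k @^-1` [set y]) (X w) * Y w)%:E)%E.
Proof.
move=> mX mY Y0 f0 g.
have gX0 k w : 0 <= g k (X w) * Y w by rewrite mulr_ge0// fun_ge0.
have mgX k : measurable_fun setT (fun w => (g k (X w) * Y w)%:E).
  apply/measurable_EFinP/measurable_funM => //.
  by apply: measurableT_comp.
transitivity (\int[mu]_w limn (fun k => (g k (X w) * Y w)%:E))%E.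
  apply: eq_integral => w _; apply/esym/cvg_lim => //.
  rewrite EFinM; under eq_fun do rewrite EFinM.
  apply: cvgeZr => //.
  by apply: (@cvg_nnsfun_approx _ _ _ _ measurableT _ mf) => // u _; rewrite lee_fin.
rewrite monotone_convergence//; last 2 first.
- by move=> k w _; rewrite lee_fin.
- move=> w _ a b ab; rewrite lee_fin ler_wpM2r//.
  exact/lefP/nd_nnsfun_approx.
congr (limn _); apply/funext => k.
transitivity (\int[mu]_w \sum_(y \in range (g k))
    (y * (\1_(g k @^-1` [set y]) (X w) * Y w))%:E)%E.
  apply: eq_integral => w _; rewrite fsumEFin//.
  congr _%:E; rewrite [g k (X w)]fimfunE mulr_fsuml.
  by apply: eq_fsbigr => y _; rewrite mulrA.
have mI y : measurable_fun setT (fun w => \1_(g k @^-1` [set y]) (X w) * Y w).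
  apply: measurable_funM => //; apply: measurableT_comp => //.
rewrite ge0_integral_fsum//; last 2 first.
- by move=> y; apply/measurable_EFinP; apply: measurable_funM => //.
- move=> y w _; rewrite lee_fin indicE.
  case: (boolP (_ \in _)) => [|_]; last by rewrite mul0r mulr0.
  by rewrite inE mul1r => <-; rewrite gX0.
apply: eq_fsbigr => y; rewrite inE => -[u _ <-].
rewrite -ge0_integralZl//=; last 3 first.
- apply/measurable_EFinP; apply: measurable_funM => //.
  by apply: measurableT_comp => //.
- by move=> w _; rewrite lee_fin mulr_ge0.
- by rewrite lee_fin fun_ge0.
Qed.

(** Two measure spaces that agree on indicators agree on all nonnegative
    functions. With constant or density weights Y1, Y2, this covers both the
    passage from a law to its density and the factorization of an expectation
    over an independent factor. *)
Lemma ge0_integral_comp_eq d1 d2 d' (T1 : measurableType d1)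
    (T2 : measurableType d2) (U : measurableType d') (R : realType)
    (mu1 : {measure set T1 -> \bar R}) (mu2 : {measure set T2 -> \bar R})
    (X1 : T1 -> U) (X2 : T2 -> U) (Y1 : T1 -> R) (Y2 : T2 -> R) (f : U -> R) :
    measurable_fun setT X1 -> measurable_fun setT Y1 -> (forall w, 0 <= Y1 w) ->
    measurable_fun setT X2 -> measurable_fun setT Y2 -> (forall w, 0 <= Y2 w) ->
    (forall B, measurable B -> \int[mu1]_w (\1_B (X1 w) * Y1 w)%:E =
                               \int[mu2]_w (\1_B (X2 w) * Y2 w)%:E)%E ->
    measurable_fun setT f -> (forall u, 0 <= f u) ->
  (\int[mu1]_w (f (X1 w) * Y1 w)%:E = \int[mu2]_w (f (X2 w) * Y2 w)%:E)%E.
Proof.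
move=> mX1 mY1 Y10 mX2 mY2 Y20 H mf f0.
have mf' : measurable_fun setT (EFin \o f) by exact/measurable_EFinP.
rewrite !(ge0_integral_comp_sfun _ mf')//.
congr (limn _); apply/funext => k.
by apply: eq_fsbigr => y _; rewrite H.
Qed.

(** * Expectations of products of independent variables *)

(** The definition of independence is the case of indicators g i; indicators
    are then replaced by arbitrary functions one index at a time, the induction
    hypothesis being what [ge0_integral_comp_eq] asks for. *)
Lemma mutually_independent_integral_prod d (T : measurableType d)
    (R : realType) (P : probability T R) (n : nat) (X : 'I_n -> {RV P >-> R})
    (g : 'I_n -> R -> R) (G : 'I_n -> R) :
    mutually_independent X ->
    (forall i, measurable_fun setT (g i)) -> (forall i u, 0 <= g i u) ->
    (forall i, \int[P]_w (g i (X i w))%:E = (G i)%:E)%E ->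
  (\int[P]_w (\prod_i g i (X i w))%:E = (\prod_i G i)%:E)%E.
Proof.
move=> indX mg g0 gG.
suff main k : forall (g : 'I_n -> R -> R) (G : 'I_n -> R),
    (forall i, measurable_fun setT (g i)) -> (forall i u, 0 <= g i u) ->
    (forall i, \int[P]_w (g i (X i w))%:E = (G i)%:E)%E ->
    (forall i : 'I_n, (k <= i)%N -> exists2 B, measurable B & g i = \1_B) ->
    (\int[P]_w (\prod_i g i (X i w))%:E = (\prod_i G i)%:E)%E.
  by apply: (main n) => // i; rewrite leqNgt ltn_ord.
elim: k => [|k IH] {g G mg g0 gG} g G mg g0 gG gB.
  have [B BP] : exists B : 'I_n -> set R,
      forall i, measurable (B i) /\ g i = \1_(B i).
    have /choice[B BP] i : exists B : set R, measurable B /\ g i = \1_B.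
      by have [B mB gE] := gB i isT; exists B.
    by exists B.
  have mB i : measurable (B i) by have [] := BP i.
  have GE i : P (X i @^-1` B i) = (G i)%:E.
    rewrite -gG (BP i).2.
    have := integral_indic P measurableT (measurable_funPTI (X i) (mB i)).
    rewrite setIT => <-.
    by apply: eq_integral => w _; rewrite !indicE.
  have := indX [set: 'I_n]%SET B mB.
  rewrite [X in _ = X -> _](_ : _ = (\prod_i G i)%:E); last first.
    by rewrite -prodEFin; apply: eq_big => i; rewrite ?finset.in_setT// GE.
  move=> <-.
  set A := [set w | _].
  have mA : measurable A.
    rewrite (_ : A = \bigcap_(i in setT) (X i @^-1` B i)); last first.
      by apply/seteqP; split => w /= Aw i _; apply: Aw; rewrite ?finset.in_setT.
    apply: fin_bigcap_measurable => // i _; exact: measurable_funPTI.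
  have := integral_indic P measurableT mA; rewrite setIT => <-.
  apply: eq_integral => w _; congr _%:E; rewrite indicE.
  case: (boolP (w \in A)) => [|/negP wA].
    rewrite inE => Aw; apply: big1 => i _.
    by rewrite (BP i).2 indicE mem_set//; apply: Aw; rewrite finset.in_setT.
  apply/eqP; rewrite prodf_seq_eq0.
  apply/negPn/negP => /hasPn H; apply: wA; apply/mem_set => /= i _.
  have := H i (mem_index_enum i); rewrite /= (BP i).2 indicE.
  by case: (boolP (X i w \in B i)) => [/set_mem//|]; rewrite eqxx.
have [nk|kn] := leqP n k.
  by apply: IH => // i ki; have := ltn_ord i; rewrite ltnNge (leq_trans nk ki).
pose j := Ordinal kn.
have G0 i : 0 <= G i.
  by rewrite -lee_fin -gG; apply: integral_ge0 => w _; rewrite lee_fin.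
have mgX i : measurable_fun setT (fun w => g i (X i w)) by apply: measurableT_comp.
pose Y w := \prod_(i < n | i != j) g i (X i w).
pose c := \prod_(i < n | i != j) G i.
have mY : measurable_fun setT Y.
  rewrite /Y; under eq_fun do rewrite big_mkcond.
  by apply: measurable_prod => i _; case: (i != j).
transitivity (\int[P]_w (g j (X j w) * Y w)%:E)%E.
  by apply: eq_integral => w _; rewrite (bigD1 j).
rewrite (bigD1 j)//= -/c.
transitivity (\int[P]_w (g j (X j w) * (cst c : T -> R) w)%:E)%E; last first.
  under eq_integral do rewrite /= mulrC EFinM.
  rewrite ge0_integralZl//=.
  - by rewrite gG -EFinM mulrC.
  - exact/measurable_EFinP.
  - by move=> w _; rewrite lee_fin.
  - by rewrite lee_fin prodr_ge0.
apply: ge0_integral_comp_eq => //.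
- by move=> w; rewrite prodr_ge0.
- by move=> w /=; rewrite prodr_ge0.
move=> B mB /=.
pose g' i := if i == j then \1_B else g i.
pose G' i := if i == j then fine (P (X j @^-1` B)) else G i.
have PB : (\int[P]_w (\1_B (X j w))%:E = P (X j @^-1` B))%E.
  have := integral_indic P measurableT (measurable_funPTI (X j) mB).
  by rewrite setIT => <-; apply: eq_integral => w _; rewrite !indicE.
transitivity (\int[P]_w (\prod_i g' i (X i w))%:E)%E.
  apply: eq_integral => w _; rewrite (bigD1 j)//= /g' eqxx; congr (_ * _)%:E.
  by apply: eq_bigr => i /negPf ->.
rewrite (IH _ G').
- rewrite (bigD1 j)//= /G' eqxx.
  rewrite [X in (_ * X)%:E = _](_ : _ = c); last first.
    by apply: eq_bigr => i /negPf ->.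
  under eq_integral do rewrite /= mulrC EFinM.
  rewrite ge0_integralZl//=.
  + by rewrite PB mulrC EFinM fineK// fin_num_measure//; exact: measurable_funPTI.
  + by apply/measurable_EFinP; apply: measurableT_comp.
  + by rewrite lee_fin prodr_ge0.
- by move=> i; rewrite /g'; case: ifP.
- by move=> i u; rewrite /g'; case: ifP => // _; rewrite indicE.
- move=> i; rewrite /g' /G'; case: eqP => // ->.
  by rewrite PB fineK// fin_num_measure//; exact: measurable_funPTI.
- move=> i; rewrite leq_eqVlt => /orP[/eqP ki|ki]; rewrite /g'.
    have -> : i == j by apply/eqP/val_inj; rewrite /= ki.
    by exists B.
  by case: eqP => _; [exists B|exact: gB].
Qed.

(** * Euclidean inner product and the empirical norm *)

Section EuclideanProduct.
Variable R : realType.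

Definition dotv n (u v : 'cV[R]_n) : R := \sum_i u i 0 * v i 0.

Lemma dotvC n (u v : 'cV[R]_n) : dotv u v = dotv v u.
Proof. by apply: eq_bigr => i _; rewrite mulrC. Qed.

Lemma dotvDr n (u v w : 'cV[R]_n) : dotv u (v + w) = dotv u v + dotv u w.
Proof. by rewrite /dotv -big_split; apply: eq_bigr => i _; rewrite mxE mulrDr. Qed.

Lemma dotvZr n a (u v : 'cV[R]_n) : dotv u (a *: v) = a * dotv u v.
Proof. by rewrite /dotv mulr_sumr; apply: eq_bigr => i _; rewrite mxE mulrCA. Qed.

Lemma dotvDl n (u v w : 'cV[R]_n) : dotv (v + w) u = dotv v u + dotv w u.
Proof. by rewrite dotvC dotvDr !(dotvC u). Qed.

Lemma dotvZl n a (u v : 'cV[R]_n) : dotv (a *: v) u = a * dotv v u.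
Proof. by rewrite dotvC dotvZr dotvC. Qed.

Lemma dotvNr n (u v : 'cV[R]_n) : dotv u (- v) = - dotv u v.
Proof. by rewrite -scaleN1r dotvZr mulN1r. Qed.

Lemma dotvNl n (u v : 'cV[R]_n) : dotv (- v) u = - dotv v u.
Proof. by rewrite dotvC dotvNr dotvC. Qed.

Lemma dotv0r n (u : 'cV[R]_n) : dotv u 0 = 0.
Proof. by rewrite /dotv big1// => i _; rewrite mxE mulr0. Qed.

Lemma dotv0l n (u : 'cV[R]_n) : dotv 0 u = 0.
Proof. by rewrite dotvC dotv0r. Qed.

Lemma dotvE n (u v : 'cV[R]_n) : dotv u v = (u^T *m v) 0 0.
Proof. by rewrite mxE; apply: eq_bigr => i _; rewrite mxE. Qed.

Lemma dotv_mulmx n p (A : 'M[R]_(p, n)) (u : 'cV[R]_p) (v : 'cV[R]_n) :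
  dotv u (A *m v) = dotv (A^T *m u) v.
Proof. by rewrite !dotvE trmx_mul trmxK mulmxA. Qed.

Lemma dotvv_ge0 n (u : 'cV[R]_n) : 0 <= dotv u u.
Proof. by apply: sumr_ge0 => i _; rewrite -expr2 sqr_ge0. Qed.

Lemma dotvv_eq0 n (u : 'cV[R]_n) : (dotv u u == 0) = (u == 0).
Proof.
apply/eqP/eqP => [u0|->]; last by rewrite dotv0r.
apply/matrixP => i j; rewrite ord1 mxE; apply/eqP; rewrite -sqrf_eq0 expr2.
move/eqP: u0; rewrite /dotv psumr_eq0 => [|k _]; last by rewrite -expr2 sqr_ge0.
by move/allP => /(_ i (mem_index_enum i)).
Qed.

Lemma dotv_CauchySchwarz n (u v : 'cV[R]_n) :
  dotv u v <= Num.sqrt (dotv u u) * Num.sqrt (dotv v v).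
Proof.
rewrite -sqrtrM ?dotvv_ge0//.
apply: le_trans (ler_norm _) _; rewrite -sqrtr_sqr ler_sqrt; last first.
  by rewrite mulr_ge0// dotvv_ge0.
have [->|v0] := eqVneq v 0; first by rewrite !dotv0r expr0n mulr0.
have vv : 0 < dotv v v by rewrite lt_def dotvv_eq0 v0 dotvv_ge0.
have := dotvv_ge0 (dotv v v *: u - dotv u v *: v).
rewrite !(dotvDl, dotvDr, dotvNl, dotvNr, dotvZl, dotvZr) (dotvC v u).
set a := dotv u u; set b := dotv u v; set c := dotv v v => h.
have : 0 <= c * (a * c - b ^+ 2).
  apply: le_trans h _; rewrite le_eqVlt; apply/orP; left; apply/eqP; ring.
by rewrite pmulr_rge0// subr_ge0.
Qed.

End EuclideanProduct.

Lemma sqnormnE (R : realType) n (u : 'cV[R]_n) : sqnormn u = dotv u u / n%:R.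
Proof. by rewrite /sqnormn /dotv; under eq_bigr do rewrite expr2. Qed.

Lemma sqnormn_ge0 (R : realType) n (u : 'cV[R]_n) : 0 <= sqnormn u.
Proof. by rewrite sqnormnE divr_ge0 ?dotvv_ge0. Qed.

Lemma normn_sqr (R : realType) n (u : 'cV[R]_n) : normn u ^+ 2 = sqnormn u.
Proof. by rewrite sqr_sqrtr ?sqnormn_ge0. Qed.

Lemma measurable_dotv d (T : measurableType d) (R : realType) n
    (e : T -> 'cV[R]_n) (a : 'cV[R]_n) :
    (forall i, measurable_fun setT (fun w => e w i 0)) ->
  measurable_fun setT (fun w => dotv a (e w)).
Proof. by move=> me; apply: measurable_sum => i; apply: measurable_funM. Qed.

Lemma measurable_normsq_mulmx d (T : measurableType d) (R : realType) n p
    (A : 'M[R]_(p, n)) (e : T -> 'cV[R]_n) :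
    (forall i, measurable_fun setT (fun w => e w i 0)) ->
  measurable_fun setT (fun w => dotv (A *m e w) (A *m e w)).
Proof.
move=> me; apply: measurable_sum => i.
suff m : measurable_fun setT (fun w => (A *m e w) i 0) by exact: measurable_funM.
under eq_fun do rewrite mxE.
by apply: measurable_sum => j; apply: measurable_funM.
Qed.

(** * Gaussian moment generating functions *)

Lemma ge0_integral_normal_distribution d (T : measurableType d) (R : realType)
    (P : probability T R) (X : {RV P >-> R}) (m s : R) (f : R -> R) :
    (forall B, measurable B -> distribution P X B = normal_prob m s B) ->
    measurable_fun setT f -> (forall u, 0 <= f u) ->
  (\int[P]_w (f (X w))%:E =
   \int[lebesgue_measure]_u (f u * normal_pdf m s u)%:E)%E.
Proof.
move=> law mf f0.
transitivity (\int[P]_w (f (X w) * (cst 1 : T -> R) w)%:E)%E.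
  by apply: eq_integral => w _; rewrite mulr1.
apply: (@ge0_integral_comp_eq _ _ _ _ _ _ _ P lebesgue_measure X (@id R)
  (cst 1) (normal_pdf m s)) => //.
- exact: measurable_normal_pdf.
- by move=> u; exact: normal_pdf_ge0.
move=> B mB.
transitivity (normal_prob m s B).
  have := integral_indic P measurableT (measurable_funPTI X mB).
  rewrite setIT -law// /distribution /pushforward => <-.
  by apply: eq_integral => w _; rewrite mulr1 !indicE.
rewrite /normal_prob [LHS]integral_mkcond; apply: eq_integral => u _.
rewrite patchE indicE; case: (u \in B); first by rewrite mul1r.
by rewrite mul0r.
Qed.

(** Completing the square: e^{au} times the centred density is a multiple of
    the density with mean s^2 a. *)
Lemma integral_normal_pdf_expR (R : realType) (s a : R) : s != 0 ->
  (\int[lebesgue_measure]_u (expR (a * u) * normal_pdf 0 s u)%:E =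
   (expR (s ^+ 2 * a ^+ 2 / 2))%:E)%E.
Proof.
move=> s0.
transitivity (\int[lebesgue_measure]_u
    ((expR (s ^+ 2 * a ^+ 2 / 2))%:E * (normal_pdf (s ^+ 2 * a) s u)%:E))%E.
  apply: eq_integral => u _; rewrite -EFinM; congr _%:E.
  rewrite !normal_pdfE//= mulrCA [RHS]mulrCA; congr (_ * _).
  rewrite /normal_fun -!expRD; congr expR.
  by field.
rewrite ge0_integralZl//=.
- by rewrite integral_normal_pdf mule1.
- by apply/measurable_EFinP; exact: measurable_normal_pdf.
- by move=> u _; rewrite lee_fin normal_pdf_ge0.
Qed.

(** The integrand is a multiple of the centred density with variance
    1 / (1 - s). *)
Lemma integral_normal_pdf_expR_sqr (R : realType) (s : R) : s < 1 ->
  (\int[lebesgue_measure]_u (expR (s / 2 * u ^+ 2) * normal_pdf 0 1 u)%:E =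
   ((Num.sqrt (1 - s))^-1)%:E)%E.
Proof.
move=> s1; have r0 : 0 < Num.sqrt (1 - s) by rewrite sqrtr_gt0 subr_gt0.
set r := Num.sqrt (1 - s) in r0 *.
have rr : r ^+ 2 = 1 - s by rewrite sqr_sqrtr// subr_ge0 ltW.
have ri : r^-1 != 0 by rewrite invr_eq0 gt_eqF.
transitivity (\int[lebesgue_measure]_u
    (r^-1%:E * (normal_pdf 0 r^-1 u)%:E))%E.
  apply: eq_integral => u _; rewrite -EFinM; congr _%:E.
  rewrite !normal_pdfE ?oner_neq0//= mulrCA [RHS]mulrA; congr (_ * _); last first.
    rewrite /normal_fun -!expRD; congr expR.
    rewrite subr0 exprVn rr; field.
    by rewrite gt_eqF// subr_gt0.
  rewrite /normal_peak exprVn expr1n mul1r.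
  rewrite -[X in _ = _ * X^-1]divr1 -mulrnAr sqrtrM ?invr_ge0 ?sqr_ge0// sqrtrV ?sqr_ge0//.
  rewrite sqrtr_sqr gtr0_norm// divr1 invfM invrK mulrA mulVf ?mul1r// gt_eqF//.
rewrite ge0_integralZl//=.
- by rewrite integral_normal_pdf mule1.
- by apply/measurable_EFinP; exact: measurable_normal_pdf.
- by move=> u _; rewrite lee_fin normal_pdf_ge0.
- by rewrite lee_fin invr_ge0 ltW.
Qed.

(** A bound on the moment generating function of every linear form; the
    Gaussian noise satisfies it with equality. *)
Definition subgaussian d (T : measurableType d) (R : realType)
    (P : probability T R) n (v : R) (e : T -> 'cV[R]_n) : Prop :=
  forall a : 'cV[R]_n, (\int[P]_w (expR (dotv a (e w)))%:E <=
                        (expR (v / 2 * dotv a a))%:E)%E.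

Lemma isotropic_gaussian_mgf d (T : measurableType d) (R : realType)
    (P : probability T R) n (s : R) (eps : 'I_n -> {RV P >-> R})
    (a : 'cV[R]_n) : s != 0 -> isotropic_gaussian s eps ->
  (\int[P]_w (expR (dotv a (\col_i eps i w)))%:E =
   (expR (s ^+ 2 / 2 * dotv a a))%:E)%E.
Proof.
move=> s0 [law indep].
have mgf1 (i : 'I_n) c :
    (\int[P]_w (expR (c * eps i w))%:E = (expR (s ^+ 2 * c ^+ 2 / 2))%:E)%E.
  have mexp : measurable_fun setT (fun u : R => expR (c * u)).
    by apply: measurableT_comp => //; exact: measurable_funM.
  rewrite -integral_normal_pdf_expR//.
  apply: (ge0_integral_normal_distribution (f := fun u => expR (c * u))) => //.
  exact: law.
under eq_integral => w _.
  rewrite /dotv expR_sum.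
  under eq_bigr do rewrite mxE.
  over.
rewrite (mutually_independent_integral_prod indep
  (g := fun i u => expR (a i 0 * u)) (G := fun i => expR (s ^+ 2 * a i 0 ^+ 2 / 2))).
- rewrite -expR_sum; congr (expR _)%:E.
  by rewrite /dotv mulr_sumr; apply: eq_bigr => i _; rewrite mulrAC expr2.
- by move=> i; apply: measurableT_comp => //; exact: measurable_funM.
- by move=> i u; exact: expR_ge0.
- by move=> i; exact: mgf1.
Qed.

(** * Chi-square type tail of a projection *)

(** An orthogonal projection of positive rank splits off a unit vector of its
    range. The rank drops because u lies in the range of Pi and in the kernel of
    the remaining projection. *)
Lemma projmx_split (R : realType) n k (Pi : 'M[R]_n) :
    Pi^T = Pi -> Pi *m Pi = Pi -> (\rank Pi <= k.+1)%N -> Pi != 0 ->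
  exists u : 'cV[R]_n, let Pi' := Pi - u *m u^T in
    [/\ dotv u u = 1, Pi *m u = u, Pi'^T = Pi', Pi' *m Pi' = Pi' &
        (\rank Pi' <= k)%N].
Proof.
move=> Pis Pii rk Pi0.
have [j wj0] : exists j, col j Pi != 0.
  apply/existsP; apply: contraNT Pi0; rewrite negb_exists => /forallP Pc.
  apply/eqP/matrixP => i j; have := Pc j; rewrite negbK => /eqP/colP/(_ i).
  by rewrite !mxE.
set w := col j Pi in wj0.
have Piw : Pi *m w = w by rewrite /w colE mulmxA Pii.
have ww : 0 < dotv w w by rewrite lt_def dotvv_eq0 wj0 dotvv_ge0.
pose u := (Num.sqrt (dotv w w))^-1 *: w.
have uu : dotv u u = 1.
  rewrite dotvZl dotvZr mulrA -invfM -expr2 sqr_sqrtr ?dotvv_ge0//.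
  by rewrite mulVf// gt_eqF.
have Piu : Pi *m u = u by rewrite -scalemxAr Piw.
have uPi : u^T *m Pi = u^T by rewrite -[Pi]Pis -trmx_mul Piu.
have uu1 : u^T *m u = 1%:M.
  by apply/matrixP => a b; rewrite !ord1 -dotvE uu mxE.
exists u => Pi'; split => //.
- by rewrite linearB/= Pis trmx_mul trmxK.
- rewrite mulmxBl !mulmxBr Pii mulmxA Piu -[u *m u^T *m Pi]mulmxA uPi.
  by rewrite -[u *m u^T *m (u *m u^T)]mulmxA [u^T *m (u *m _)]mulmxA uu1 mul1mx subrr subr0.
have Pi'u : Pi' *m u = 0 by rewrite mulmxBl Piu -mulmxA uu1 mulmx1 subrr.
have sub : (Pi' <= Pi)%MS.
  have -> : Pi' = Pi' *m Pi by rewrite mulmxBl Pii -mulmxA uPi.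
  exact: submxMl.
rewrite -ltnS (leq_trans _ rk)// ltnNge; apply/negP => rPi.
have /(submx_trans _) : (Pi <= Pi')%MS.
  by have /mxrank_leqif_sup[_ <-] := sub; rewrite eqn_leq rPi mxrankS.
move=> /(_ _ u^T); rewrite -{1}uPi submxMl => /(_ isT)/submxP[X uX].
have : u^T *m u = 0 by rewrite uX -mulmxA Pi'u mulmx0.
by rewrite uu1 => /matrixP/(_ 0 0)/eqP; rewrite !mxE eqxx oner_eq0.
Qed.

(** By induction on the rank, with a linear term b orthogonal to the range of
    Pi to absorb what one step produces: for u split off from Pi,
    exp(s (u'e)^2 / 2) is the average over a standard Gaussian g of
    exp(sqrt(s) g u'e). Exchanging the two integrals moves sqrt(s) g u into the
    linear term of the remaining projection, and the average over g of the
    resulting bound contributes the factor (1 - s v)^{-1/2}. *)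
Lemma subgaussian_proj_mgf d (T : measurableType d) (R : realType)
    (P : probability T R) n (e : T -> 'cV[R]_n) (v s : R) :
    (forall i, measurable_fun setT (fun w => e w i 0)) ->
    subgaussian P v e ->
    0 <= s -> 0 <= v -> s * v < 1 ->
  forall k (Pi : 'M[R]_n) (b : 'cV[R]_n),
    Pi^T = Pi -> Pi *m Pi = Pi -> (\rank Pi <= k)%N -> Pi *m b = 0 ->
  (\int[P]_w (expR (s / 2 * dotv (Pi *m e w) (Pi *m e w) + dotv b (e w)))%:E <=
   ((Num.sqrt (1 - s * v))^-1 ^+ k * expR (v / 2 * dotv b b))%:E)%E.
Proof.
move=> me mgf s0 v0 sv1.
have [r0 r1] : 0 < Num.sqrt (1 - s * v) /\ Num.sqrt (1 - s * v) <= 1.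
  rewrite sqrtr_gt0 subr_gt0 -[X in _ /\ _ <= X]sqrtr1 ler_wsqrtr//.
  by rewrite gerBl mulr_ge0.
have mdot a : measurable_fun setT (fun w => dotv a (e w)) by exact: measurable_dotv.
elim=> [|k IH] Pi b Pis Pii rk Pib.
  move: rk; rewrite leqn0 mxrank_eq0 => /eqP ->.
  under eq_integral do rewrite mul0mx dotv0r mulr0 add0r.
  by rewrite expr0 mul1r; exact: mgf.
have [->|Pi0] := eqVneq Pi 0.
  under eq_integral do rewrite mul0mx dotv0r mulr0 add0r.
  apply: le_trans (mgf b) _; rewrite lee_fin ler_peMl ?expR_ge0//.
  by rewrite exprn_ege1// invf_ge1.
have [u [uu Piu Pi's Pi'i rk']] := projmx_split Pis Pii rk Pi0.
set Pi' := Pi - u *m u^T in Pi's Pi'i rk'.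
have ub : dotv u b = 0 by rewrite -Piu -{1}Pis -dotv_mulmx Pib dotv0r.
have uu1 : u^T *m u = 1%:M.
  by apply/matrixP => a c; rewrite !ord1 -dotvE uu mxE.
have Pi'u : Pi' *m u = 0 by rewrite mulmxBl Piu -mulmxA uu1 mulmx1 subrr.
have Pi'b : Pi' *m b = 0.
  rewrite mulmxBl Pib -mulmxA.
  have -> : u^T *m b = 0.
    by apply/matrixP => a c; rewrite !ord1 -dotvE ub mxE.
  by rewrite mulmx0 subrr.
have split_norm w : dotv (Pi *m e w) (Pi *m e w) =
    dotv (Pi' *m e w) (Pi' *m e w) + dotv u (e w) ^+ 2.
  have -> : Pi *m e w = Pi' *m e w + dotv u (e w) *: u.
    have uE : u^T *m e w = (dotv u (e w))%:M.
      by apply/matrixP => a c; rewrite !ord1 -dotvE mxE.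
    by rewrite mulmxBl -[u *m u^T *m _]mulmxA uE mul_mx_scalar subrK.
  rewrite !(dotvDl, dotvDr, dotvZl, dotvZr) uu.
  have uPi'e : dotv u (Pi' *m e w) = 0 by rewrite dotv_mulmx Pi's Pi'u dotv0l.
  by rewrite (dotvC _ u) uPi'e !mulr0 !addr0 add0r mulr1 expr2.
(* the mixture over the Gaussian variable z.2 *)
pose F (z : T * R) : R := expR (s / 2 * dotv (Pi' *m e z.1) (Pi' *m e z.1)
   + dotv (b + (Num.sqrt s * z.2) *: u) (e z.1)) * normal_pdf 0 1 z.2.
have mF : measurable_fun setT F.
  apply: measurable_funM; last first.
    by apply: measurableT_comp => //; exact: measurable_normal_pdf.
  apply: measurableT_comp => //; apply: measurable_funD.
    apply: measurable_funM => //.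
    apply: (measurableT_comp (f := fun w => dotv (Pi' *m e w) (Pi' *m e w))) => //.
    exact: measurable_normsq_mulmx.
  rewrite (_ : (fun z => _) = (fun z : T * R =>
      dotv b (e z.1) + (Num.sqrt s * z.2) * dotv u (e z.1))); last first.
    by apply/funext => z; rewrite dotvDl dotvZl.
  apply: measurable_funD; first exact: (measurableT_comp (f := fun w => dotv b (e w))).
  apply: measurable_funM; first exact: measurable_funM.
  exact: (measurableT_comp (f := fun w => dotv u (e w))).
have F0 z : 0 <= F z by rewrite mulr_ge0 ?expR_ge0 ?normal_pdf_ge0.
rewrite (_ : (\int[P]_w _ =
  \int[P]_w \int[lebesgue_measure]_y (F (w, y))%:E)%E); last first.
  apply: eq_integral => w _; rewrite split_norm.
  set A := dotv (Pi' *m e w) _; set c := dotv u (e w).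
  transitivity ((expR (s / 2 * A + dotv b (e w)))%:E *
      \int[lebesgue_measure]_y (expR ((Num.sqrt s * c) * y) * normal_pdf 0 1 y)%:E)%E.
    rewrite integral_normal_pdf_expR ?oner_neq0// -EFinM -expRD exprMn sqr_sqrtr//.
    by congr (expR _)%:E; field.
  rewrite -ge0_integralZl//=.
  - apply: eq_integral => y _; rewrite /F /= -EFinM mulrA -expRD dotvDl dotvZl.
    by rewrite -/A -/c; congr (expR _ * _)%:E; ring.
  - apply/measurable_EFinP; apply: measurable_funM; last exact: measurable_normal_pdf.
    by apply: measurableT_comp => //; exact: measurable_funM.
  - by move=> y _; rewrite lee_fin mulr_ge0 ?expR_ge0 ?normal_pdf_ge0.
rewrite (fubini_tonelli (m1 := P) (m2 := lebesgue_measure) (fun z => (F z)%:E)); last 2 first.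
- exact/measurable_EFinP.
- by move=> z; rewrite lee_fin.
set C := (Num.sqrt (1 - s * v))^-1; set B := expR (v / 2 * dotv b b).
have C0 : 0 <= C by rewrite invr_ge0 ltW.
apply: (@le_trans _ _ (\int[lebesgue_measure]_y
    ((C ^+ k * B)%:E * (expR (s * v / 2 * y ^+ 2) * normal_pdf 0 1 y)%:E))%E).
  apply: ge0_le_integral => //=.
  - by move=> y _; apply: integral_ge0 => w _; rewrite lee_fin.
  - apply: (measurable_fun_fubini_tonelli_G (m1 := P) (fun z => (F z)%:E)).
      exact/measurable_EFinP.
    by move=> z; rewrite lee_fin.
  - apply/measurable_EFinP; apply: measurable_funM => //.
    apply: measurable_funM; last exact: measurable_normal_pdf.
    apply: measurableT_comp => //; apply: measurable_funM => //.
  move=> y _; rewrite /F /=.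
  set b' := b + (Num.sqrt s * y) *: u.
  have b'b' : dotv b' b' = dotv b b + s * y ^+ 2.
    rewrite !(dotvDl, dotvDr, dotvZl, dotvZr) uu ub (dotvC b u) ub.
    rewrite !mulr0 addr0 add0r mulr1 mulrACA -!expr2 sqr_sqrtr//.
  under eq_integral do rewrite mulrC EFinM.
  rewrite ge0_integralZl//=; last 2 first.
  - apply/measurable_EFinP; apply: measurableT_comp => //.
    apply: measurable_funD; last exact: mdot.
    by apply: measurable_funM => //; exact: measurable_normsq_mulmx.
  - by rewrite lee_fin normal_pdf_ge0.
  have Pi'b' : Pi' *m b' = 0 by rewrite mulmxDr Pi'b -scalemxAr Pi'u scaler0 addr0.
  apply: le_trans (lee_wpmul2l _ (IH Pi' b' Pi's Pi'i rk' Pi'b')) _.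
    by rewrite lee_fin normal_pdf_ge0.
  rewrite -!EFinM lee_fin -/C b'b' le_eqVlt; apply/orP; left; apply/eqP.
  rewrite mulrDr expRD.
  rewrite /B (_ : v / 2 * (s * y ^+ 2) = s * v / 2 * y ^+ 2); last by ring.
  ring.
rewrite ge0_integralZl//=.
- rewrite integral_normal_pdf_expR_sqr// -EFinM lee_fin -/C exprSr.
  by rewrite mulrAC.
- apply/measurable_EFinP; apply: measurable_funM; last exact: measurable_normal_pdf.
  apply: measurableT_comp => //; exact: measurable_funM.
- by move=> y _; rewrite lee_fin mulr_ge0 ?expR_ge0 ?normal_pdf_ge0.
- by rewrite lee_fin mulr_ge0 ?exprn_ge0 ?expR_ge0.
Qed.

Lemma markov_ge0 d (T : measurableType d) (R : realType)
    (P : {measure set T -> \bar R}) (f : T -> R) (c : R) :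
    measurable_fun setT f -> (forall w, 0 <= f w) -> 0 < c ->
  (P [set w | c <= f w]%R <= (c^-1)%:E * \int[P]_w (f w)%:E)%E.
Proof.
move=> mf f0 c0; set A := [set w | _].
have mA : measurable A.
  rewrite -[A]setTI (_ : A = f @^-1` `[c, +oo[); first exact: mf.
  by apply/seteqP; split => w /=; rewrite in_itv/= andbT.
rewrite lee_pdivlMl//.
rewrite -{1}[A]setIT -integral_indic// -ge0_integralZl//=.
- apply: ge0_le_integral => //=.
  + by move=> w _; rewrite mule_ge0 ?lee_fin// ltW.
  + apply/measurable_EFinP; apply: measurable_funM => //.
  + exact/measurable_EFinP.
  + move=> w _; rewrite -EFinM lee_fin indicE.
    by have [|_] := boolP (w \in A); rewrite ?mulr0// mulr1 inE.
- exact/measurable_EFinP.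
- by rewrite lee_fin ltW.
Qed.

(** Chernoff bound with the optimal exponent. With u = sqrt (2x/r) the threshold
    is v r (1+u)^2, and s v = 1 - (1+u)^{-2} gives the bound
    (1+u)^r exp(- r ((1+u)^2 - 1) / 2) <= exp(- r u^2 / 2), as 1 + u <= e^u. *)
Lemma subgaussian_proj_tail d (T : measurableType d) (R : realType)
    (P : probability T R) n (e : T -> 'cV[R]_n) (v x : R) r (Pi : 'M[R]_n) :
    (forall i, measurable_fun setT (fun w => e w i 0)) ->
    subgaussian P v e ->
    0 < v -> 0 < x -> Pi^T = Pi -> Pi *m Pi = Pi -> (\rank Pi <= r)%N ->
  (P [set w | v * (Num.sqrt r%:R + Num.sqrt (2 * x)) ^+ 2 <=
              dotv (Pi *m e w) (Pi *m e w)]%R <= (expR (- x))%:E)%E.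
Proof.
move=> me mgf v0 x0 Pis Pii rk.
have x2 : 0 < 2 * x by rewrite mulr_gt0.
have [r0|r_gt0] := posnP r.
  move: rk; rewrite r0 leqn0 mxrank_eq0 => /eqP ->.
  rewrite [X in P X](_ : _ = set0) ?measure0 ?lee_fin ?expR_ge0//.
  apply/seteqP; split => w //=.
  rewrite mul0mx dotv0r sqrtr0 add0r sqr_sqrtr; last exact: ltW.
  by rewrite leNgt mulr_gt0.
have rR : 0 < r%:R :> R by rewrite ltr0n.
pose u : R := Num.sqrt (2 * x / r%:R).
have u0 : 0 < u by rewrite sqrtr_gt0 divr_gt0.
have uu : u ^+ 2 = 2 * x / r%:R by rewrite sqr_sqrtr// ltW// divr_gt0.
have -> : (Num.sqrt r%:R + Num.sqrt (2 * x)) ^+ 2 = r%:R * (1 + u) ^+ 2.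
  have -> : Num.sqrt (2 * x) = Num.sqrt r%:R * u.
    by rewrite -sqrtrM ?ler0n// [r%:R * _]mulrC divfK// gt_eqF.
  by rewrite -{1}[Num.sqrt r%:R]mulr1 -mulrDr exprMn sqr_sqrtr// ler0n.
pose q := 1 - (1 + u) ^- 2.
have u1 : 1 < 1 + u by rewrite ltrDl.
have u1_gt0 : 0 < 1 + u by rewrite addr_gt0.
have q0 : 0 < q by rewrite subr_gt0 invf_lt1 ?exprn_gt0// exprn_egt1.
have q1 : q < 1 by rewrite gtrBl invr_gt0 exprn_gt0.
pose s := q / v.
have sv : s * v = q by rewrite divfK// gt_eqF.
have sC : (Num.sqrt (1 - s * v))^-1 = 1 + u.
  by rewrite sv /q subKr sqrtrV ?exprn_ge0 1?ltW// sqrtr_sqr gtr0_norm// invrK.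
have s0 : 0 < s by rewrite divr_gt0.
pose L := r%:R * (1 + u) ^+ 2.
have mnorm : measurable_fun setT (fun w => dotv (Pi *m e w) (Pi *m e w)).
  exact: measurable_normsq_mulmx.
apply: (@le_trans _ _ (P [set w | expR (q / 2 * L) <=
    expR (s / 2 * dotv (Pi *m e w) (Pi *m e w))]%R)).
  rewrite le_eqVlt; apply/orP; left; apply/eqP; congr (P _).
  apply/seteqP; split => w /=; rewrite ler_expR -sv -/L;
    by rewrite (_ : s * v / 2 * L = s / 2 * (v * L)) ?ler_pM2l ?divr_gt0//; ring.
apply: le_trans (markov_ge0 _ _ _ _) _ => //.
- by apply: measurableT_comp => //; exact: measurable_funM.
- exact: expR_gt0.
have mgf_le : (\int[P]_w (expR (s / 2 * dotv (Pi *m e w) (Pi *m e w)))%:E <=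
    ((1 + u) ^+ r)%:E)%E.
  have sv1 : s * v < 1 by rewrite sv.
  have := subgaussian_proj_mgf me mgf (ltW s0) (ltW v0) sv1 Pis Pii rk (mulmx0 _ Pi).
  rewrite sC dotv0r mulr0 expR0 mulr1; apply: le_trans.
  by under [leRHS]eq_integral do rewrite dotv0l addr0.
apply: le_trans (lee_wpmul2l _ mgf_le) _; first by rewrite lee_fin invr_ge0 expR_ge0.
rewrite -EFinM lee_fin -expRN.
apply: (@le_trans _ _ (expR (- (q / 2 * L)) * expR u ^+ r)).
  rewrite ler_wpM2l ?expR_ge0// lerXn2r ?nnegrE ?expR_ge0 ?expR_ge1Dx//.
  by rewrite ltW.
rewrite -expRM_natl -expRD ler_expR le_eqVlt; apply/orP; left; apply/eqP.
have -> : x = r%:R * u ^+ 2 / 2.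
  by rewrite uu mulrCA divff ?gt_eqF//; field.
rewrite /L /q; field.
by rewrite gt_eqF.
Qed.

(** * The l1 norm, near-Auerbach bases and total sensitivity *)

Lemma norm1_ge0 (R : realType) p (v : 'cV[R]_p) : 0 <= norm1 v.
Proof. by apply: sumr_ge0. Qed.

Lemma norm1Z (R : realType) p a (v : 'cV[R]_p) : norm1 (a *: v) = `|a| * norm1 v.
Proof. by rewrite /norm1 mulr_sumr; apply: eq_bigr => i _; rewrite mxE normrM. Qed.

Lemma norm1_eq0 (R : realType) p (v : 'cV[R]_p) : norm1 v = 0 -> v = 0.
Proof.
move=> /eqP; rewrite /norm1 psumr_eq0// => /allP v0.
apply/colP => i; rewrite mxE; apply/eqP; rewrite -normr_eq0.
exact: v0 (mem_index_enum i).
Qed.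

Lemma le_entry_norm1 (R : realType) p (v : 'cV[R]_p) i : `|v i 0| <= norm1 v.
Proof. by rewrite /norm1 (bigD1 i)//= lerDl sumr_ge0. Qed.

Lemma norm1_triangle (R : realType) p (u v : 'cV[R]_p) :
  norm1 (u + v) <= norm1 u + norm1 v.
Proof.
rewrite /norm1 -big_split; apply: ler_sum => i _; rewrite mxE; exact: ler_normD.
Qed.

(** A crude bound from the Leibniz formula: it only serves to make the
    determinants over the unit ball bounded. *)
Lemma norm_det_le (R : realType) r (C : 'M[R]_r) (M : R) :
  (forall i j, `|C i j| <= M) -> `|\det C| <= M ^+ r *+ r`!.
Proof.
move=> CM; apply: le_trans (ler_norm_sum _ _ _) _.
apply: (@le_trans _ _ (\sum_(s : 'S_r) M ^+ r)); last first.
  by rewrite sumr_const card_Sn.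
apply: ler_sum => s _; rewrite normrM normrX normrN1 expr1n mul1r normr_prod.
rewrite -[X in _ ^+ X]card_ord -prodr_const.
by apply: ler_prod => i _; rewrite normr_ge0 CM.
Qed.

Lemma det_replace_col (R : realType) r (C : 'M[R]_r) (y : 'cV[R]_r) j :
  \det (\matrix_(i, k) (if k == j then y i 0 else C i k)) = (\adj C *m y) j 0.
Proof.
rewrite (expand_det_col _ j) mxE; apply: eq_bigr => i _.
rewrite !mxE eqxx mulrC; congr (_ * _).
rewrite /cofactor; congr (_ * \det _).
by apply/matrixP => a b; rewrite !mxE eq_sym (negbTE (neq_lift _ _)).
Qed.

(** Auerbach's lemma for the norm y |-> ||V y||_1, up to a factor 1 + delta:
    the columns of C are in the unit ball and their coordinate functionals have
    norm at most 1 + delta. Take C whose determinant is within 1 + delta of the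
    supremum over the unit ball: replacing its column j by another vector y of
    the ball multiplies the determinant by the coordinate of y along j (Cramer's rule).
    A near-maximizer needs no compactness. *)
Lemma near_auerbach (R : realType) p r (V : 'M[R]_(p, r)) (delta : R) :
    0 < delta -> row_free V^T ->
  exists2 C : 'M[R]_r, C \in unitmx & (forall j, norm1 (V *m col j C) <= 1) /\
    forall (y : 'cV[R]_r) j,
      `|(invmx C *m y) j 0| <= (1 + delta) * norm1 (V *m y).
Proof.
move=> d0 Vfree.
pose ball (C : 'M[R]_r) := forall j, norm1 (V *m col j C) <= 1.
pose E := [set `|\det C| | C in ball].
have [L LV] : exists L : 'M[R]_(r, p), L *m V = 1%:M.
  have /row_freeP[B VB] := Vfree.
  by exists B^T; apply: trmx_inj; rewrite trmx_mul trmxK VB trmx1.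
have Eub : has_ubound E.
  pose M := \sum_i \sum_k `|L i k|.
  exists (M ^+ r *+ r`!) => _ [C Cb <-]; apply: norm_det_le => i j.
  have -> : C i j = \sum_k L i k * (V *m col j C) k 0.
    transitivity ((L *m (V *m col j C)) i 0); last by rewrite mxE.
    by rewrite mulmxA LV mul1mx mxE.
  apply: le_trans (ler_norm_sum _ _ _) _.
  apply: (@le_trans _ _ (\sum_k `|L i k|)); last first.
    by rewrite /M [leRHS](bigD1 i)//= lerDl; do 2!apply: sumr_ge0 => ? _.
  apply: ler_sum => k _; rewrite normrM ler_piMr//.
  exact: le_trans (le_entry_norm1 _ k) (Cb j).
(* c times the identity is in the unit ball, so the supremum is positive *)
pose c := (1 + \sum_k \sum_j `|V k j|)^-1.
have c0 : 0 < c by rewrite invr_gt0 ltr_pwDl// sumr_ge0// => k _; rewrite sumr_ge0.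
have Ec : E (c ^+ r).
  exists c%:M; last by rewrite det_scalar normrX gtr0_norm.
  move=> j; have -> : V *m col j c%:M = c *: col j V.
    by rewrite -mul_scalar_mx colE [V *m _]mulmxA mul_mx_scalar -scalemxAl -colE mul_scalar_mx.
  rewrite norm1Z gtr0_norm// mulrC ler_pdivrMr ?invr_gt0 1?mul1r;
    last by rewrite -invr_gt0.
  apply: (@le_trans _ _ (\sum_k \sum_j `|V k j|)); last by rewrite lerDr.
  apply: ler_sum => k _; rewrite mxE (bigD1 j)//= lerDl.
  by apply: sumr_ge0.
have sE : has_sup E by split => //; exists (c ^+ r).
have s0 : 0 < sup E.
  apply: (@lt_le_trans _ _ (c ^+ r)); first exact: exprn_gt0.
  exact: ub_le_sup.
have [_ [C Cb <-] Cs] : exists2 z, E z & sup E / (1 + delta) < z.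
  have : 0 < sup E - sup E / (1 + delta).
    by rewrite subr_gt0 ltr_pdivrMr ?addr_gt0// ltr_pMr// ltrDl.
  by move=> /sup_adherent/(_ sE)[z Ez]; rewrite subKr; exists z.
have d1 : 0 < 1 + delta by rewrite addr_gt0.
have detC : 0 < `|\det C| by apply: le_lt_trans Cs; rewrite divr_ge0// ltW.
have Cu : C \in unitmx by rewrite unitmxE unitfE -normr_gt0.
exists C => //; split => // y j.
have unit_ball z : norm1 (V *m z) <= 1 -> `|(invmx C *m z) j 0| <= 1 + delta.
  move=> z1; rewrite /invmx Cu -scalemxAl mxE -det_replace_col normrM normfV.
  rewrite ler_pdivrMl//; apply: (@le_trans _ _ (sup E)); last first.
    by rewrite mulrC -ler_pdivrMl// mulrC ltW.
  apply: ub_le_sup => //; set C' := \matrix_(_, _) _; exists C' => // k.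
  have [->|kj] := eqVneq k j.
    by have -> : col j C' = z by apply/colP => i; rewrite !mxE eqxx.
  have -> : col k C' = col k C by apply/colP => i; rewrite !mxE (negbTE kj).
  exact: Cb.
have [Vy0|Vy0] := eqVneq (norm1 (V *m y)) 0.
  have -> : y = 0 by rewrite -[y]mul1mx -LV -mulmxA (norm1_eq0 Vy0) mulmx0.
  by rewrite !mulmx0 mxE normr0 mulr_ge0 ?norm1_ge0// ltW.
have Vy : 0 < norm1 (V *m y) by rewrite lt_def Vy0 norm1_ge0.
have := unit_ball ((norm1 (V *m y))^-1 *: y).
rewrite -!scalemxAr norm1Z normfV gtr0_norm// mulVf// lexx => /(_ isT).
by rewrite mxE normrM normfV (gtr0_norm Vy) ler_pdivrMl// mulrC.
Qed.

(** The largest share of ||A h||_1 that a single row can carry, summed over the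
    rows, is at most the rank of A, however many rows there are. In a
    near-Auerbach basis of the column space, the coordinates of A h are at most
    (1 + delta) ||A h||_1, and summing the l1 norms of the basis vectors gives
    the rank. *)
Lemma l1_sensitivity (R : realType) p n (A : 'M[R]_(p, n)) (delta : R) :
    0 < delta ->
  exists2 l : 'I_p -> R, (forall k, 0 <= l k) /\
      \sum_k l k <= (1 + delta) * (\rank A)%:R &
    forall (h : 'cV[R]_n) k, `|(A *m h) k 0| <= l k * norm1 (A *m h).
Proof.
move=> d0; set V := col_base A.
have Vfree : row_free V^T by rewrite /row_free mxrank_tr; exact: col_base_full.
have [C Cu [Cb CV]] := near_auerbach d0 Vfree.
have d1 : 0 < 1 + delta by rewrite addr_gt0.
exists (fun k => (1 + delta) * \sum_j `|(V *m C) k j|).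
  split; first by move=> k; rewrite mulr_ge0 ?sumr_ge0// ltW.
  rewrite -mulr_sumr ler_pM2l// exchange_big/=.
  rewrite -[X in _ <= X%:R]card_ord -sumr_const; apply: ler_sum => j _.
  apply: le_trans (Cb j); rewrite colE mulmxA -colE /norm1.
  by apply: ler_sum => k _; rewrite [in leRHS]mxE.
move=> h k; have -> : A *m h = V *m (row_base A *m h) by rewrite mulmxA mulmx_base.
move: (row_base A *m h) => y.
have {1}-> : V *m y = V *m C *m (invmx C *m y).
  by rewrite -[RHS]mulmxA [C *m _]mulmxA mulmxV// mul1mx.
rewrite mxE; apply: le_trans (ler_norm_sum _ _ _) _.
rewrite mulrAC [X in _ <= X]mulrC mulr_suml; apply: ler_sum => j _.
by rewrite normrM ler_wpM2l.
Qed.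

(** * Controlling the noise by hyperbolic cosines *)

(** Markov's inequality; each bracket has expectation at most 2 e^{tau^2/2}. The
    allowance 1 + e^{-2 tau^2} in the sum of the weights is exactly the ratio
    of 2 cosh(tau^2) to e^{tau^2}. *)
Lemma weighted_cosh_tail d (T : measurableType d) (R : realType)
    (P : probability T R) n p (e : T -> 'cV[R]_n) (v tau : R)
    (a : 'I_p -> 'cV[R]_n) (l : 'I_p -> R) (r : R) :
    (forall i, measurable_fun setT (fun w => e w i 0)) ->
    subgaussian P v e ->
    (forall k, v * dotv (a k) (a k) <= 1) -> (forall k, 0 <= l k) ->
    \sum_k l k <= (1 + expR (- 2 * tau ^+ 2)) * r ->
  (P [set w | expR (tau ^+ 2) + expR (- tau ^+ 2) <=
      \sum_k l k * (expR (tau * dotv (a k) (e w)) +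
                    expR (- (tau * dotv (a k) (e w))))]%R <=
   (2 * r * expR (- (tau ^+ 2 / 2)))%:E)%E.
Proof.
move=> me mgf va l0 lr.
have mexp c k : measurable_fun setT (fun w => expR (c * dotv (a k) (e w))).
  by apply: measurableT_comp => //; apply: measurable_funM => //; exact: measurable_dotv.
have mterm k : measurable_fun setT (fun w => l k *
    (expR (tau * dotv (a k) (e w)) + expR (- (tau * dotv (a k) (e w))))).
  apply: measurable_funM => //; apply: measurable_funD => //.
  by under eq_fun do rewrite -mulNr; exact: mexp.
have mgf1 c k : c ^+ 2 = tau ^+ 2 ->
    (\int[P]_w (expR (c * dotv (a k) (e w)))%:E <= (expR (tau ^+ 2 / 2))%:E)%E.
  move=> ct; under eq_integral do rewrite -dotvZl.
  apply: le_trans (mgf _) _; rewrite lee_fin ler_expR dotvZl dotvZr.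
  rewrite (mulrA c) -expr2 ct.
  have := ler_wpM2l (sqr_ge0 tau) (va k); rewrite mulr1; lra.
apply: le_trans (markov_ge0 _ _ _ _) _.
- by apply: measurable_sum => k.
- by move=> w; apply: sumr_ge0 => k _; rewrite mulr_ge0 ?addr_ge0 ?expR_ge0.
- by rewrite addr_gt0 ?expR_gt0.
under eq_integral do rewrite -sumEFin.
rewrite ge0_integral_sum//=; last 2 first.
- by move=> k; exact/measurable_EFinP.
- by move=> k w _; rewrite lee_fin mulr_ge0 ?addr_ge0 ?expR_ge0.
apply: (@le_trans _ _ ((expR (tau ^+ 2) + expR (- tau ^+ 2))^-1%:E *
    \sum_k (l k * (2 * expR (tau ^+ 2 / 2)))%:E)%E).
  apply: lee_wpmul2l; first by rewrite lee_fin invr_ge0 addr_ge0 ?expR_ge0.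
  apply: lee_sum => k _.
  under eq_integral do rewrite EFinM.
  rewrite ge0_integralZl//=.
  - rewrite EFinM; apply: lee_wpmul2l; first by rewrite lee_fin.
    under eq_integral do rewrite EFinD.
    rewrite ge0_integralD//=.
    + rewrite mulr_natl mulr2n EFinD; apply: leeD; first exact: mgf1.
      by under eq_integral do rewrite -mulNr; apply: mgf1; rewrite sqrrN.
    + exact/measurable_EFinP.
    + by apply/measurable_EFinP; under eq_fun do rewrite -mulNr; exact: mexp.
  - apply/measurable_EFinP; apply: measurable_funD => //.
    by under eq_fun do rewrite -mulNr; exact: mexp.
  - by rewrite lee_fin.
rewrite sumEFin -EFinM lee_fin -mulr_suml ler_pdivrMl ?addr_gt0 ?expR_gt0//.
apply: (@le_trans _ _ ((1 + expR (- 2 * tau ^+ 2)) * r * (2 * expR (tau ^+ 2 / 2)))).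
  by rewrite ler_wpM2r// mulr_ge0 ?expR_ge0.
rewrite le_eqVlt; apply/orP; left; apply/eqP.
have -> : expR (tau ^+ 2 / 2) = expR (tau ^+ 2) * expR (- (tau ^+ 2 / 2)).
  by rewrite -expRD; congr expR; field.
have -> : expR (- tau ^+ 2) = expR (- 2 * tau ^+ 2) * expR (tau ^+ 2).
  by rewrite -expRD; congr expR; ring.
ring.
Qed.

(** Jensen's inequality for cosh under the probability weights q k / sum q, which
    are dominated by l k. It is proved by summing the tangent line of cosh at
    tau^2, so that nothing is divided by sum q. *)
Lemma cosh_jensen (R : realType) p (q l x : 'I_p -> R) (tau : R) :
    0 < tau -> (forall k, 0 <= q k) -> (forall k, q k <= l k * \sum_j q j) ->
    \sum_k l k * (expR (tau * x k) + expR (- (tau * x k))) <=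
      expR (tau ^+ 2) + expR (- tau ^+ 2) ->
  \sum_k q k * `|x k| <= tau * \sum_k q k.
Proof.
move=> tau0 q0 ql lcosh.
set Q := \sum_k q k in ql *.
have Q0 : 0 <= Q by exact: sumr_ge0.
set ch := _ + _ in lcosh.
pose sh : R := expR (tau ^+ 2) - expR (- tau ^+ 2).
have sh0 : 0 < sh.
  by rewrite subr_gt0 ltr_expR gtrN// exprn_gt0.
have tangent k : ch + sh * (tau * `|x k| - tau ^+ 2) <=
    expR (tau * x k) + expR (- (tau * x k)).
  have -> : expR (tau * x k) + expR (- (tau * x k)) =
      expR (tau * `|x k|) + expR (- (tau * `|x k|)).
    have [_|_] := ger0P (x k); first by [].
    by rewrite mulrN opprK addrC.
  set y := tau * `|x k|; set b := tau ^+ 2.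
  have e1 : expR b * (1 + (y - b)) <= expR y.
    have -> : expR y = expR b * expR (y - b) by rewrite -expRD addrC subrK.
    by rewrite ler_wpM2l ?expR_ge0// expR_ge1Dx.
  have e2 : expR (- b) * (1 - (y - b)) <= expR (- y).
    have -> : expR (- y) = expR (- b) * expR (- (y - b)).
      by rewrite -expRD; congr expR; ring.
    by rewrite ler_wpM2l ?expR_ge0// expR_ge1Dx.
  have := lerD e1 e2; rewrite /ch /sh -/b; lra.
have := ler_wpM2l Q0 lcosh.
have : Q * ch + sh * tau * (\sum_k q k * `|x k| - tau * Q) <=
    Q * \sum_k l k * (expR (tau * x k) + expR (- (tau * x k))).
  rewrite mulr_sumr.
  apply: (@le_trans _ _ (\sum_k q k * (ch + sh * (tau * `|x k| - tau ^+ 2)))).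
    rewrite le_eqVlt; apply/orP; left; apply/eqP.
    transitivity (\sum_k ((ch - sh * tau ^+ 2) * q k + sh * tau * (q k * `|x k|))).
      rewrite big_split -!mulr_sumr -/Q /=; ring.
    by apply: eq_bigr => k _; ring.
  apply: ler_sum => k _; apply: le_trans (ler_wpM2l (q0 k) (tangent k)) _.
  rewrite mulrA [Q * _]mulrC; apply: ler_wpM2r => //.
move=> h1 h2; have : sh * tau * (\sum_k q k * `|x k| - tau * Q) <= 0 by lra.
by rewrite pmulr_rle0 ?mulr_gt0// subr_le0.
Qed.

(** The logarithm involves the rank of A and not its number of rows: the weights
    come from [l1_sensitivity], applied to A with its rows scaled by the norms of
    the columns of X. *)
Lemma noise_event d (T : measurableType d) (R : realType)
    (P : probability T R) n p (e : T -> 'cV[R]_n) (sigma t : R)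
    (A : 'M[R]_(p, n)) (X : 'M[R]_(n, p)) :
    (forall i, measurable_fun setT (fun w => e w i 0)) ->
    subgaussian P (sigma ^+ 2) e ->
    0 < sigma -> 0 < t ->
  exists G : set T, [/\ measurable G, (P (~` G) <= (expR (- t))%:E)%E &
    forall w, G w -> forall h, dotv (e w) (X *m (A *m h)) <=
      sigma * Num.sqrt (2 * ln (2 * (\rank A)%:R) + 2 * t) *
      \sum_k Num.sqrt (dotv (col k X) (col k X)) * `|(A *m h) k 0|].
Proof.
move=> me mgf s0 t0.
have [A0|rA] := posnP (\rank A).
  exists setT; split; first exact: measurableT.
    by rewrite setCT measure0 lee_fin expR_ge0.
  move=> w _ h; move/eqP: A0; rewrite mxrank_eq0 => /eqP ->.
  rewrite mul0mx mulmx0 dotv0r mulr_ge0//.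
    by rewrite mulr_ge0 ?sqrtr_ge0// ltW.
  by apply: sumr_ge0 => k _; rewrite mulr_ge0 ?sqrtr_ge0.
have r1 : 1 <= (\rank A)%:R :> R by rewrite ler1n.
set B := 2 * ln _ + 2 * t.
have B0 : 0 < B.
  rewrite ltr_wpDl ?mulr_gt0// mulr_ge0// ln_ge0//.
  by apply: le_trans r1 _; rewrite ler_peMl// ler1n.
set tau := Num.sqrt B.
have tau0 : 0 < tau by rewrite sqrtr_gt0.
have tt : tau ^+ 2 = B by rewrite sqr_sqrtr// ltW.
pose nd k := Num.sqrt (dotv (col k X) (col k X)).
have nd0 k : 0 <= nd k by rewrite sqrtr_ge0.
have ndnd k : nd k ^+ 2 = dotv (col k X) (col k X) by rewrite sqr_sqrtr// dotvv_ge0.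
(* if the column is zero, this is the zero vector *)
pose a k := (sigma * nd k)^-1 *: col k X.
pose A' := diag_mx (\row_k nd k) *m A.
have A'h h k : (A' *m h) k 0 = nd k * (A *m h) k 0.
  by rewrite -mulmxA mul_diag_mx !mxE.
have [l [l0 lr] lA] := @l1_sensitivity R p n A' (expR (- 2 * tau ^+ 2)) (expR_gt0 _).
have lr' : \sum_k l k <= (1 + expR (- 2 * tau ^+ 2)) * (\rank A)%:R.
  apply: le_trans lr _; rewrite ler_wpM2l ?addr_ge0 ?expR_ge0//.
  by rewrite ler_nat mxrankM_maxr.
have va k : sigma ^+ 2 * dotv (a k) (a k) <= 1.
  rewrite dotvZl dotvZr -ndnd.
  have [->|ndk] := eqVneq (nd k) 0; first by rewrite expr0n !mulr0.
  rewrite le_eqVlt; apply/orP; left; apply/eqP; field.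
  by rewrite ndk gt_eqF.
pose ch w := \sum_k l k *
  (expR (tau * dotv (a k) (e w)) + expR (- (tau * dotv (a k) (e w)))).
have mch : measurable_fun setT ch.
  apply: measurable_sum => k; apply: measurable_funM => //.
  have mt : measurable_fun setT (fun w => tau * dotv (a k) (e w)).
    by apply: measurable_funM => //; exact: measurable_dotv.
  apply: measurable_funD; apply: measurableT_comp => //.
  exact: measurable_funN.
set c := expR (tau ^+ 2) + expR (- tau ^+ 2).
exists [set w | ch w < c]; split.
- rewrite [X in measurable X](_ : _ = ch @^-1` `]-oo, c[); last first.
    by apply/seteqP; split => w /=; rewrite in_itv.
  by rewrite -[X in measurable X]setTI; exact: mch.
- rewrite [X in P X](_ : _ = [set w | c <= ch w]); last first.
    by apply/seteqP; split => w /=; rewrite leNgt => /negP.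
  apply: le_trans (weighted_cosh_tail me mgf va l0 lr') _.
  rewrite lee_fin tt /B.
  have -> : - ((2 * ln (2 * (\rank A)%:R) + 2 * t) / 2) =
      - ln (2 * (\rank A)%:R) - t :> R by field.
  have r2 : 0 < 2 * (\rank A)%:R :> R by rewrite mulr_gt0// ltr0n.
  by rewrite expRD expRN lnK ?posrE// mulrA divff ?gt_eqF// mul1r.
move=> w /ltW chw h.
pose q k := nd k * `|(A *m h) k 0|.
have q0 k : 0 <= q k by rewrite mulr_ge0.
have qE k : q k = `|(A' *m h) k 0| by rewrite A'h normrM ger0_norm.
have ql k : q k <= l k * \sum_j q j.
  rewrite (eq_bigr (fun j => `|(A' *m h) j 0|)) => [|j _]; last exact: qE.
  by rewrite qE; exact: lA.
have := cosh_jensen tau0 q0 ql chw => jensen.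
have dE k : dotv (col k X) (e w) = sigma * nd k * dotv (a k) (e w).
  rewrite dotvZl; have [ndk|ndk] := eqVneq (nd k) 0.
    have /eqP : dotv (col k X) (col k X) = 0 by rewrite -ndnd ndk expr0n.
    by rewrite dotvv_eq0 => /eqP ->; rewrite dotv0l !mulr0.
  by rewrite mulrA divff ?mul1r// mulf_neq0// gt_eqF.
rewrite dotv_mulmx.
apply: (@le_trans _ _ (sigma * \sum_k q k * `|dotv (a k) (e w)|)); last first.
  by rewrite -[leRHS]mulrA ler_wpM2l// ltW.
rewrite mulr_sumr; apply: ler_sum => k _.
have -> : (X^T *m e w) k 0 = dotv (col k X) (e w).
  by rewrite mxE; apply: eq_bigr => i _; rewrite !mxE.
rewrite dE; apply: le_trans (ler_norm _) _.
rewrite !normrM (gtr0_norm s0) (ger0_norm (nd0 k)) /q.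
by rewrite le_eqVlt; apply/orP; left; apply/eqP; ring.
Qed.

(** * The analysis estimator: strong convexity and measurability *)

(** The squared distance is strongly convex: compare fh with the points
    (1 - s) fh + s f and let s tend to 0. *)
Lemma argmin_strong_convexity (R : realType) n (pen : 'cV[R]_n -> R)
    (y fh : 'cV[R]_n) :
    (forall (s : R) a b, 0 <= s -> s <= 1 ->
      pen ((1 - s) *: a + s *: b) <= (1 - s) * pen a + s * pen b) ->
    (forall f, sqnormn (y - fh) + pen fh <= sqnormn (y - f) + pen f) ->
  forall f, sqnormn (y - fh) + pen fh + sqnormn (fh - f) <=
    sqnormn (y - f) + pen f.
Proof.
move=> cvx fhmin f.
have N0 := sqnormn_ge0 (fh - f).
have key s : 0 < s -> s <= 1 ->
    sqnormn (y - fh) + pen fh + sqnormn (fh - f) - (sqnormn (y - f) + pen f) <=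
    s * sqnormn (fh - f).
  move=> s0 s1; have := fhmin ((1 - s) *: fh + s *: f).
  have := cvx s fh f (ltW s0) s1.
  have -> : sqnormn (y - ((1 - s) *: fh + s *: f)) =
      (1 - s) * sqnormn (y - fh) + s * sqnormn (y - f) -
      s * (1 - s) * sqnormn (fh - f).
    have -> : y - ((1 - s) *: fh + s *: f) = (1 - s) *: (y - fh) + s *: (y - f).
      by apply/colP => i; rewrite !mxE; ring.
    have -> : fh - f = (y - f) - (y - fh) by apply/colP => i; rewrite !mxE; ring.
    rewrite !sqnormnE; move: (y - fh) (y - f) => a b.
    rewrite !(dotvDl, dotvDr, dotvNl, dotvNr, dotvZl, dotvZr) (dotvC b a).
    by ring.
  move=> h1 h2; rewrite -(ler_pM2l s0); lra.
rewrite -subr_le0 leNgt; apply/negP; set Delta := _ - _ => D0.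
have [NDelta|DN] := ltrP (sqnormn (fh - f)) Delta.
  by have := key 1 ltr01 (lexx _); rewrite mul1r -/Delta leNgt NDelta.
have NN : 0 < sqnormn (fh - f) by exact: lt_le_trans DN.
have NN2 : 0 < 2 * sqnormn (fh - f) by rewrite mulr_gt0.
have s1 : Delta / (2 * sqnormn (fh - f)) <= 1 by rewrite ler_pdivrMr//; lra.
have := key _ (divr_gt0 D0 NN2) s1; rewrite -/Delta.
have -> : Delta / (2 * sqnormn (fh - f)) * sqnormn (fh - f) = Delta / 2.
  by field; rewrite gt_eqF.
by lra.
Qed.

Section AnalysisEstimator.
Variables (R : realType) (m n : nat) (D : 'M[R]_(m, n)) (lambda : R).
Hypothesis lambda_ge0 : 0 <= lambda.
Variable fhat : 'cV[R]_n -> 'cV[R]_n.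
Hypothesis fhat_argmin : analysis_estimator D lambda fhat.

Lemma analysis_estimator_strong (y f : 'cV[R]_n) :
  sqnormn (y - fhat y) + 2 * lambda * norm1 (D *m fhat y) + sqnormn (fhat y - f)
  <= sqnormn (y - f) + 2 * lambda * norm1 (D *m f).
Proof.
apply: (argmin_strong_convexity (pen := fun f => 2 * lambda * norm1 (D *m f))).
  move=> s a b s0 s1.
  rewrite mulrCA [s * (_ * _)]mulrCA -mulrDr; apply: ler_wpM2l; first by rewrite mulr_ge0.
  rewrite mulmxDr -!scalemxAr; apply: le_trans (norm1_triangle _ _) _.
  by rewrite !norm1Z !ger0_norm// subr_ge0.
exact: fhat_argmin.
Qed.

(** Add the strong convexity inequalities at y1 and y2, each tested against the
    other minimizer: the penalties cancel. *)
Lemma analysis_estimator_lipschitz (y1 y2 : 'cV[R]_n) : (0 < n)%N ->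
  dotv (fhat y1 - fhat y2) (fhat y1 - fhat y2) <= dotv (y1 - y2) (y1 - y2).
Proof.
move=> n0; have nR : 0 < n%:R^-1 :> R by rewrite invr_gt0 ltr0n.
have := analysis_estimator_strong y2 (fhat y1).
have := analysis_estimator_strong y1 (fhat y2).
rewrite !sqnormnE => h1 h2.
have h3 := dotvv_ge0 ((y1 - y2) - (fhat y1 - fhat y2)).
rewrite -(ler_pM2r nR); move: h1 h2 (ler_wpM2r (ltW nR) h3); rewrite mul0r.
move: (fhat y1) (fhat y2) => a b.
rewrite !(dotvDl, dotvDr, dotvNl, dotvNr).
rewrite (dotvC b a) (dotvC y2 y1) (dotvC a y1) (dotvC b y1) (dotvC a y2) (dotvC b y2).
lra.
Qed.

End AnalysisEstimator.

(** An open set is a countable union of boxes with rational centres. *)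
Lemma measurable_open_preimage d (T : measurableType d) (R : realType) n
    (X : T -> 'cV[R]_n) (U : set 'cV[R]_n) :
    (forall i, measurable_fun setT (fun w => X w i 0)) -> open U ->
  measurable (X @^-1` U).
Proof.
move=> mX oU.
pose box (q : {ffun 'I_n -> rat}) k :=
  [set y : 'cV[R]_n | forall i, `|y i 0 - ratr (q i)| < k.+1%:R^-1].
pose F (qk : {ffun 'I_n -> rat} * nat) : set T :=
  if `[< box qk.1 qk.2 `<=` U >] then X @^-1` box qk.1 qk.2 else set0.
rewrite (_ : X @^-1` U = \bigcup_qk F qk).
  apply: countable_bigcupT_measurable => //= -[q k]; rewrite /F.
  case: asboolP => // _.
  rewrite (_ : _ @^-1` _ = \bigcap_(i in [set: 'I_n])
      ((fun w => `|X w i 0 - ratr (q i)|) @^-1` `]-oo, k.+1%:R^-1[)); last first.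
    apply/seteqP; split => w /= H i; first by move=> _; rewrite /= in_itv/= H.
    by have := H i Logic.I; rewrite /= in_itv.
  apply: fin_bigcap_measurable => // i _; rewrite -[X in measurable X]setTI.
  suff mf : measurable_fun setT (fun w => `|X w i 0 - ratr (q i)|) by exact: mf.
  by apply: measurableT_comp => //; exact: measurable_funB.
apply/seteqP; split => w /=; last first.
  by move=> [[q k] _]; rewrite /F; case: asboolP => // qkU Xw; exact: qkU.
move=> UXw.
have := open_nbhs_nbhs (conj oU UXw) => /nbhs_ballP[e /= e0 eU].
have [k ke] : exists k, k.+1%:R^-1 < e / 2 :> R.
  have /(ltr_add_invr (R := R))[k] : (0 < e / 2)%R by rewrite divr_gt0.
  by rewrite add0r => ?; exists k.
have /choice[q qX] i : exists q : rat, `|X w i 0 - ratr q| < k.+1%:R^-1.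
  have [|q] := @rat_in_itvoo R (X w i 0 - k.+1%:R^-1) (X w i 0 + k.+1%:R^-1).
    by rewrite ltrBlDr -addrA ltrDl addr_gt0// invr_gt0.
  rewrite in_itv/= => /andP[q1 q2]; exists q; rewrite ltr_norml.
  move: (k.+1%:R^-1) q1 q2 => b q1 q2.
  by apply/andP; split; lra.
exists ([ffun i => q i], k) => //; rewrite /F/= asboolT; last first.
  move=> y /= yq; apply: eU; split => // i j; rewrite ord1 /ball/=.
  have := yq i; have := qX i; rewrite ffunE !ltr_norml.
  move: (k.+1%:R^-1) ke => b ke /andP[? ?] /andP[? ?].
  by apply/andP; split; lra.
by move=> i; rewrite ffunE; exact: qX.
Qed.

(** Each coordinate of v is continuous, hence its superlevel sets are open. *)
Lemma measurable_sqnormn_lipschitz d (T : measurableType d) (R : realType) n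
    (X : T -> 'cV[R]_n) (v : 'cV[R]_n -> 'cV[R]_n) :
    (forall i, measurable_fun setT (fun w => X w i 0)) ->
    (forall x y, dotv (v x - v y) (v x - v y) <= dotv (x - y) (x - y)) ->
  measurable_fun setT (fun w => sqnormn (v (X w))).
Proof.
move=> mX vlip.
suff mv i : measurable_fun setT (fun w => v (X w) i 0).
  by apply: measurable_funM => //; apply: measurable_sum => i; exact: measurable_funX.
apply: (measurability _ (RGenOInfty.measurableE R)) => //.
move=> _ [_ [c ->] <-]; rewrite setTI.
rewrite (_ : _ @^-1` _ = X @^-1` [set y | c < v y i 0]); last first.
  by apply/seteqP; split => w /=; rewrite in_itv/= andbT.
apply: measurable_open_preimage => //.
rewrite openE => x /= cx; apply/nbhs_ballP.
pose e := (v x i 0 - c) / n.+1%:R.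
have e0 : 0 < e by rewrite divr_gt0// subr_gt0.
exists e => //= y [_ xy] /=.
have lip : `|v x i 0 - v y i 0| ^+ 2 <= n%:R * e ^+ 2.
  apply: (@le_trans _ _ (dotv (v x - v y) (v x - v y))).
    rewrite /dotv (bigD1 i)//= !mxE real_normK ?num_real// -expr2 lerDl.
    by apply: sumr_ge0 => j _; rewrite -expr2 sqr_ge0.
  apply: le_trans (vlip x y) _; rewrite /dotv.
  apply: (@le_trans _ _ (\sum_(j < n) e ^+ 2)); last by rewrite sumr_const card_ord mulr_natl.
  apply: ler_sum => j _; have := xy j 0; rewrite /ball/= !mxE -expr2.
  by move=> h; rewrite -real_normK ?num_real// lerXn2r ?nnegrE ?(ltW e0) ?(ltW h).
have : `|v x i 0 - v y i 0| < v x i 0 - c.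
  have cv : 0 <= v x i 0 - c by rewrite subr_ge0 ltW.
  rewrite -(ltr_pXn2r (n := 2)) ?nnegrE//.
  apply: le_lt_trans lip _.
  have -> : v x i 0 - c = n.+1%:R * e by rewrite mulrC divfK.
  rewrite [X in _ < X]exprMn ltr_pM2r ?exprn_gt0// -natrX ltr_nat.
  by rewrite -mulnn mulSn ltn_addr.
by rewrite ltr_norml => /andP[_]; rewrite ltrD2l ltrN2.
Qed.

(** * Active sets, weights and compatibility *)

Section ActiveSetGeometry.
Variables (R : realType) (m n : nat) (D : 'M[R]_(m, n)) (S : {set 'I_m}).
Let A := rows_in D (~: S)%SET.
Let X := mp_inv A.

Lemma rows_in_mulmx (U : {set 'I_m}) (h : 'cV[R]_n) k :
  (rows_in D U *m h) k 0 = (D *m h) (enum_val k) 0.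
Proof. by rewrite /rows_in mul_rowsub_mx mxE. Qed.

Lemma norm1_rows_in_split (h : 'cV[R]_n) :
  norm1 (D *m h) = norm1 (rows_in D S *m h) + norm1 (A *m h).
Proof.
rewrite /norm1 (bigID (mem S))/=; congr (_ + _).
  by rewrite big_enum_val; apply: eq_bigr => k _; rewrite rows_in_mulmx.
transitivity (\sum_(i in (~: S)%SET) `|(D *m h) i 0|).
  by apply: eq_bigl => i; rewrite finset.in_setC.
by rewrite big_enum_val; apply: eq_bigr => k _; rewrite rows_in_mulmx.
Qed.

Lemma omega_enum_val (k : 'I_#|(~: S)%SET|) : omega D S (enum_val k) = normn (col k X).
Proof.
rewrite /omega; set kP := boolP _; destruct kP as [kS|kS].
  by rewrite enum_valK_in.
by have := enum_valP k; rewrite (negbTE kS).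
Qed.

Lemma omega_le_gamma (k : 'I_#|(~: S)%SET|) : omega D S (enum_val k) <= gamma D S.
Proof. exact: le_bigmax_cond (enum_valP k). Qed.

Lemma gamma_ge0 : 0 <= gamma D S.
Proof. exact: bigmax_ge_id. Qed.

Lemma weightE (k : 'I_#|(~: S)%SET|) :
  weight D S (enum_val k) = 1 - normn (col k X) / gamma D S.
Proof. by rewrite /weight omega_enum_val. Qed.

Lemma weight_ge0 (k : 'I_#|(~: S)%SET|) : 0 <= weight D S (enum_val k).
Proof.
rewrite /weight subr_ge0.
have [->|g0] := eqVneq (gamma D S) 0; first by rewrite invr0 mulr0.
by rewrite ler_pdivrMr ?mul1r ?omega_le_gamma// lt_def g0 gamma_ge0.
Qed.

(** The weights lie in [0, 1], so the weighted norm is the l1 norm minus exactly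
    the amount that absorbs the noise. *)
Lemma norm1_weights_in (h : 'cV[R]_n) :
  norm1 (weights_in D S (~: S)%SET *m A *m h) =
  norm1 (A *m h) - \sum_k normn (col k X) / gamma D S * `|(A *m h) k 0|.
Proof.
rewrite /norm1 -sumrB; apply: eq_bigr => k _.
rewrite -mulmxA mul_diag_mx mxE mxE normrM ger0_norm ?weight_ge0//.
by rewrite weightE mulrBl mul1r.
Qed.

Lemma null_dimE : (null_dim D S + \rank A)%N = n.
Proof. by rewrite /null_dim mxrank_ker mxrank_tr subnK// rank_leq_col. Qed.

Lemma null_projP (Pi := 1%:M - X *m A) :
  [/\ Pi^T = Pi, Pi *m Pi = Pi & (\rank Pi <= null_dim D S)%N].
Proof.
have [a1 a2 _ a4] := penrose_mp_inv A.
have Pis : Pi^T = Pi by rewrite /Pi linearB/= trmx1 a4.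
split => //.
  rewrite /Pi mulmxBl mul1mx mulmxBr mulmx1.
  by rewrite [X *m A *m _]mulmxA a2 subrr subr0.
rewrite /null_dim mxrankS//; apply/sub_kermxP.
by rewrite -[Pi]Pis -trmx_mul mulmxBr mulmx1 mulmxA a1 subrr trmx0.
Qed.

(** A vector whose active set is S is a nonzero element of the null space as soon
    as S is nonempty. *)
Lemma active_null_dim_gt0 : active_sets D S -> S != finset.set0 ->
  (0 < null_dim D S)%N.
Proof.
move=> [f fS] /set0Pn[i iS]; rewrite lt0n; apply/negP => /eqP nd0.
have Df0 i' : i' \notin S -> (D *m f) i' 0 = 0.
  by rewrite fS finset.inE negbK -row_mul mxE => /eqP.
have Af : A *m f = 0.
  apply/colP => k; rewrite rows_in_mulmx Df0 ?mxE//.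
  by have := enum_valP k; rewrite finset.in_setC.
have f0 : f = 0.
  apply: trmx_inj; rewrite trmx0.
  have : (f^T <= kermx A^T)%MS by apply/sub_kermxP; rewrite -trmx_mul Af trmx0.
  move/eqP: nd0; rewrite /null_dim mxrank_eq0 => /eqP ->.
  by rewrite submx0 => /eqP.
by move: iS; rewrite fS finset.inE f0 mulmx0 mxE eqxx.
Qed.

End ActiveSetGeometry.

Lemma compat_ge0 (R : realType) m n (D : 'M[R]_(m, n)) S : (0 <= compat D S)%E.
Proof. exact: sqrte_ge0. Qed.

(** Homogeneity: if the bracket Q is positive, then h / Q satisfies the
    constraint that defines the compatibility constant. The hypothesis that the
    quotient is finite excludes a zero constant, since S is then nonempty and
    the numerator is positive. *)
Lemma compat_bound (R : realType) m n (D : 'M[R]_(m, n)) (S : {set 'I_m})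
    (lambda c : R) (h : 'cV[R]_n) :
    active_sets D S -> 0 < lambda ->
    ((lambda * Num.sqrt (null_dim D S)%:R)%:E / compat D S = c%:E)%E ->
  lambda * (norm1 (rows_in D S *m h) -
    norm1 (weights_in D S (~: S)%SET *m rows_in D (~: S)%SET *m h)) <=
  c * normn h.
Proof.
move=> Sact l0 cE.
set Q := norm1 _ - norm1 _.
have c0 : 0 <= c.
  rewrite -lee_fin -cE mule_ge0 ?lee_fin ?inve_ge0 ?compat_ge0//.
  by rewrite mulr_ge0 ?sqrtr_ge0 ?ltW.
have [Q0|Q0] := lerP Q 0.
  apply: (@le_trans _ _ 0); first by rewrite pmulr_rle0.
  by rewrite mulr_ge0 ?sqrtr_ge0.
have S0 : S != finset.set0.
  apply/negP => /eqP S0; move: Q0; rewrite ltNge /Q S0.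
  have -> : norm1 (rows_in D finset.set0 *m h) = 0.
    rewrite /norm1 big1// => k _; have := enum_valP k.
    by rewrite finset.in_set0.
  by rewrite sub0r oppr_le0 norm1_ge0.
have r0 : 0 < (null_dim D S)%:R :> R by rewrite ltr0n active_null_dim_gt0.
move: cE; rewrite /compat /sq_compat.
set E := [set (sqnormn f)%:E | f in _].
have E0 : (0 <= ereal_inf E)%E.
  by apply: le_ereal_inf_tmp => _ [f _ <-]; rewrite lee_fin sqnormn_ge0.
have Eh : (ereal_inf E <= (Q ^- 2 * sqnormn h)%:E)%E.
  apply: ereal_inf_lbound; exists (Q^-1 *: h).
    rewrite /= -!scalemxAr !norm1Z -mulrBr -/Q gtr0_norm ?invr_gt0//.
    by rewrite mulVf// gt_eqF.
  by rewrite !sqnormnE dotvZl dotvZr !mulrA -invfM -expr2.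
have [I IE] : exists I, ereal_inf E = I%:E.
  exists (fine (ereal_inf E)); rewrite fineK// ge0_fin_numE//.
  by apply: le_lt_trans Eh _; exact: ltry.
move: E0 Eh; rewrite IE !lee_fin => I0 Ih.
rewrite -EFinM /sqrte.
set K := Num.sqrt (_ * I).
have K0 : 0 <= K by rewrite sqrtr_ge0.
have [->|Kn0] := eqVneq K 0.
  rewrite inve0 gt0_muley ?lte_fin ?mulr_gt0 ?sqrtr_gt0//.
have Kgt0 : 0 < K by rewrite lt_def Kn0.
rewrite inver (negbTE Kn0) -EFinM => -[<-].
have KQ : K * Q <= Num.sqrt (null_dim D S)%:R * normn h.
  rewrite -(ler_pXn2r (n := 2)) ?nnegrE ?mulr_ge0 ?sqrtr_ge0 ?(ltW Q0)//.
  rewrite !exprMn normn_sqr /K !sqr_sqrtr ?ler0n ?mulr_ge0 ?ler0n//.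
  rewrite -mulrA ler_pM2l//.
  by move: Ih; rewrite mulrC ler_pdivlMr// exprn_gt0.
have -> : lambda * Num.sqrt (null_dim D S)%:R / K * normn h =
    lambda * (K^-1 * (Num.sqrt (null_dim D S)%:R * normn h)) by ring.
by rewrite ler_pM2l// ler_pdivlMl.
Qed.

Lemma oracle_inequality (R : realType) m n (D : 'M[R]_(m, n)) (S : {set 'I_m})
    (lambda a b : R) (f0 e f : 'cV[R]_n) (fhat : 'cV[R]_n -> 'cV[R]_n)
    (A := rows_in D (~: S)%SET) (X := mp_inv A) :
    (0 < n)%N -> active_sets D S -> 0 < lambda ->
    analysis_estimator D lambda fhat ->
    (forall h, dotv e (X *m (A *m h)) <= n%:R * lambda *
      \sum_k normn (col k X) / gamma D S * `|(A *m h) k 0|) ->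
    0 <= a -> dotv ((1%:M - X *m A) *m e) ((1%:M - X *m A) *m e) <= n%:R * a ^+ 2 ->
    ((lambda * Num.sqrt (null_dim D S)%:R)%:E / compat D S = b%:E)%E ->
  sqnormn (fhat (f0 + e) - f0) <=
    sqnormn (f - f0) + 4 * lambda * norm1 (A *m f) + (a + b) ^+ 2.
Proof.
move=> n0 Sact l0 fhmin noise a0 chi bE.
have nR : 0 < n%:R :> R by rewrite ltr0n.
have [Pis Pii _] := null_projP D S.
set Pi := 1%:M - _ in Pis Pii chi.
set fh := fhat (f0 + e).
pose h := fh - f.
have basic : sqnormn (fh - f0) + sqnormn h <= sqnormn (f - f0) +
    2 * (dotv e h / n%:R) + 2 * lambda * (norm1 (D *m f) - norm1 (D *m fh)).
  have := analysis_estimator_strong (ltW l0) fhmin (f0 + e) f; rewrite -/fh -/h.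
  have -> : f0 + e - fh = e - (fh - f0) by apply/colP => i; rewrite !mxE; ring.
  have -> : f0 + e - f = e - (f - f0) by apply/colP => i; rewrite !mxE; ring.
  have -> : dotv e h = dotv e (fh - f0) - dotv e (f - f0).
    rewrite -dotvNr -dotvDr; congr dotv.
    by apply/colP => i; rewrite !mxE; ring.
  rewrite !sqnormnE; move: (fh - f0) (f - f0) => g k.
  rewrite !(dotvDl, dotvDr, dotvNl, dotvNr) (dotvC g e) (dotvC k e).
  by rewrite !mulrDl !mulNr; lra.
have noise_split : dotv e h / n%:R <= a * normn h +
    lambda * (norm1 (A *m h) - norm1 (weights_in D S (~: S)%SET *m A *m h)).
  have -> : dotv e h = dotv (Pi *m e) h + dotv e (X *m (A *m h)).
    rewrite -{1}Pis -dotv_mulmx -dotvDr mulmxA -mulmxDl subrK.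
    by rewrite mul1mx.
  rewrite norm1_weights_in subKr mulrDl; apply: lerD; last first.
    by rewrite ler_pdivrMr// mulrC mulrA; exact: noise.
  rewrite ler_pdivrMr//; apply: le_trans (dotv_CauchySchwarz _ _) _.
  have -> : normn h = Num.sqrt (dotv h h) / Num.sqrt n%:R.
    by rewrite /normn sqnormnE sqrtrM ?dotvv_ge0// sqrtrV ?ler0n.
  have -> : a * (Num.sqrt (dotv h h) / Num.sqrt n%:R) * n%:R =
      Num.sqrt n%:R * a * Num.sqrt (dotv h h).
    rewrite -{2}[n%:R]sqr_sqrtr ?ler0n//; field.
    by rewrite gt_eqF// sqrtr_gt0.
  apply: ler_wpM2r; first exact: sqrtr_ge0.
  rewrite -(ler_pXn2r (n := 2)) ?nnegrE ?mulr_ge0 ?sqrtr_ge0//.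
  by rewrite exprMn !sqr_sqrtr ?dotvv_ge0 ?ler0n.
have penalty : norm1 (D *m f) - norm1 (D *m fh) <=
    norm1 (rows_in D S *m h) - norm1 (A *m h) + 2 * norm1 (A *m f).
  rewrite !(norm1_rows_in_split D S) -/A.
  have t1 : norm1 (rows_in D S *m f) <=
      norm1 (rows_in D S *m fh) + norm1 (rows_in D S *m h).
    have {1}-> : f = fh - h by rewrite /h opprB addrC subrK.
    rewrite mulmxBr; apply: le_trans (norm1_triangle _ _) _.
    by rewrite -scaleN1r norm1Z normrN1 mul1r.
  have t2 : norm1 (A *m h) <= norm1 (A *m fh) + norm1 (A *m f).
    rewrite mulmxBr; apply: le_trans (norm1_triangle _ _) _.
    by rewrite -scaleN1r norm1Z normrN1 mul1r.
  lra.
have comp := compat_bound h Sact l0 bE.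
rewrite -/A in comp.
have sq : 2 * ((a + b) * normn h) - sqnormn h <= (a + b) ^+ 2.
  rewrite -normn_sqr -subr_ge0.
  apply: le_trans (sqr_ge0 (a + b - normn h)) _.
  by rewrite le_eqVlt; apply/orP; left; apply/eqP; ring.
have := ler_wpM2l (ltW l0) penalty.
lra.
Qed.

(** * The oracle inequality with high probability *)

Theorem theorem2p1 (R : realType) (m n : nat)
  (f0 : 'cV[R]_n) (sigma : R) (sigma_gt0 : 0 < sigma)
  (d : measure_display) (T : measurableType d) (P : probability T R)
  (eps : 'I_n -> {RV P >-> R}) (eps_gauss : isotropic_gaussian sigma eps)
  (D : 'M[R]_(m, n)) (S : {set 'I_m}) (S_active : active_sets D S)
  (x t : R) (x_gt0 : 0 < x) (t_gt0 : 0 < t)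
  (lambda : R) (lambda_gt0 : 0 < lambda)
  (lambda_ge : gamma D S * sigma *
     Num.sqrt (2 * ln (2 * (n%:R - (null_dim D S)%:R)) / n%:R + 2 * t / n%:R)
     <= lambda)
  (fhat : 'cV[R]_n -> 'cV[R]_n)
  (fhat_argmin : analysis_estimator D lambda fhat) (f : 'cV[R]_n) :
  ((1 - expR (- x) - expR (- t))%:E <=
   P [set w | (sqnormn (fhat (observation f0 eps w) - f0))%:E <=
       (sqnormn (f - f0) + 4 * lambda * norm1 (rows_in D (~: S)%SET *m f))%:E +
       ((sigma * Num.sqrt (2 * x / n%:R)
         + sigma * Num.sqrt ((null_dim D S)%:R / n%:R))%:E +
        (lambda * Num.sqrt (null_dim D S)%:R)%:E / compat D S) ^+ 2])%E.
Proof.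
set F := [set w | _]; set r := null_dim D S.
pose A := rows_in D (~: S)%SET; pose X := mp_inv A.
pose e w : 'cV[R]_n := \col_i eps i w.
set a := sigma * Num.sqrt (2 * x / n%:R) + sigma * Num.sqrt (r%:R / n%:R).
have a0 : 0 <= a by rewrite addr_ge0 ?mulr_ge0 ?sqrtr_ge0 ?ltW.
set y := ((lambda * Num.sqrt r%:R)%:E / compat D S)%E.
have y0 : (0 <= y)%E.
  rewrite mule_ge0 ?inve_ge0 ?compat_ge0// lee_fin.
  by rewrite mulr_ge0 ?sqrtr_ge0 ?ltW.
have base0 : 0 <= sqnormn (f - f0) + 4 * lambda * norm1 (A *m f).
  by rewrite addr_ge0 ?sqnormn_ge0// mulr_ge0 ?norm1_ge0// mulr_ge0// ltW.
have [n0|n_gt0] := posnP n.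
  have -> : F = setT.
    apply/seteqP; split => // w _; rewrite /F/=.
    have -> : sqnormn (fhat (observation f0 eps w) - f0) = 0.
      by rewrite sqnormnE [X in X%:R]n0 invr0 mulr0.
    apply: adde_ge0; first by rewrite lee_fin.
    by rewrite mule_ge0// adde_ge0// lee_fin.
  rewrite probability_setT lee_fin.
  have := expR_ge0 (- x); have := expR_ge0 (- t); lra.
have nR : 0 < n%:R :> R by rewrite ltr0n.
have me i : measurable_fun setT (fun w => e w i 0).
  rewrite (_ : (fun w => _) = eps i); first exact: measurable_funPT.
  by apply/funext => w; rewrite mxE.
have mgf : subgaussian P (sigma ^+ 2) e.
  by move=> b; rewrite (isotropic_gaussian_mgf _ _ eps_gauss)// gt_eqF.
have [Pis Pii rPi] := null_projP D S.
pose chi w := dotv ((1%:M - X *m A) *m e w) ((1%:M - X *m A) *m e w).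
pose c := sigma ^+ 2 * (Num.sqrt r%:R + Num.sqrt (2 * x)) ^+ 2.
have cE : c = n%:R * a ^+ 2.
  have -> : a = sigma * (Num.sqrt r%:R + Num.sqrt (2 * x)) / Num.sqrt n%:R.
    rewrite /a !sqrtrM ?ler0n 1?mulr_ge0 1?ltW// sqrtrV ?ler0n//.
    by ring.
  rewrite /c !exprMn exprVn sqr_sqrtr ?ler0n//; field.
  by rewrite gt_eqF.
have mchi : measurable_fun setT chi by exact: measurable_normsq_mulmx.
pose G1 := [set w | c <= chi w].
have mG1 : measurable G1.
  rewrite [G1](_ : _ = chi @^-1` `[c, +oo[); last first.
    by apply/seteqP; split => w /=; rewrite in_itv/= andbT.
  by rewrite -[X in measurable X]setTI; exact: mchi.
have PG1 : (P G1 <= (expR (- x))%:E)%E.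
  by apply: subgaussian_proj_tail => //; rewrite exprn_gt0.
have [G2 [mG2 PG2 G2noise]] := noise_event A X me mgf sigma_gt0 t_gt0.
have rankA : (\rank A)%:R = n%:R - r%:R :> R.
  by apply/eqP; rewrite eq_sym subr_eq addrC -natrD; apply/eqP; rewrite null_dimE.
have noise w : G2 w -> forall h, dotv (e w) (X *m (A *m h)) <= n%:R * lambda *
      \sum_k normn (col k X) / gamma D S * `|(A *m h) k 0|.
  move=> G2w h; apply: le_trans (G2noise w G2w h) _.
  rewrite rankA !mulr_sumr; apply: ler_sum => k _.
  rewrite !mulrA; apply: ler_wpM2r => //.
  have sqn : 0 < Num.sqrt n%:R :> R by rewrite sqrtr_gt0.
  have normnE : normn (col k X) = Num.sqrt (dotv (col k X) (col k X)) / Num.sqrt n%:R.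
    by rewrite /normn sqnormnE sqrtrM ?dotvv_ge0// sqrtrV ?ler0n.
  have ng : normn (col k X) <= gamma D S.
    by rewrite -omega_enum_val; exact: omega_le_gamma.
  set nd := Num.sqrt (dotv _ _) in normnE *.
  have [g0|g0] := eqVneq (gamma D S) 0.
    have nd0 : nd = 0.
      have : normn (col k X) = 0 by apply/eqP; rewrite eq_le sqrtr_ge0 andbT -g0.
      by rewrite normnE => /eqP; rewrite mulf_eq0 invr_eq0 (gt_eqF sqn) orbF => /eqP.
    by rewrite normnE nd0 !(mulr0, mul0r).
  have gp : 0 < gamma D S by rewrite lt_def g0 gamma_ge0.
  rewrite normnE; set B := 2 * ln _ + 2 * t.
  have lB : gamma D S * sigma * (Num.sqrt B / Num.sqrt n%:R) <= lambda.
    move: lambda_ge; rewrite -mulrDl -/B [B / _]mulrC sqrtrM ?invr_ge0 ?ler0n//.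
    by rewrite sqrtrV ?ler0n// [_^-1 * _]mulrC.
  have : n%:R * (nd / Num.sqrt n%:R) / gamma D S *
      (gamma D S * sigma * (Num.sqrt B / Num.sqrt n%:R)) <=
      n%:R * (nd / Num.sqrt n%:R) / gamma D S * lambda.
    by apply: ler_wpM2l lB; rewrite !mulr_ge0 ?invr_ge0 ?sqrtr_ge0 ?ltW.
  move=> H; apply: (le_trans (le_trans _ H)).
    rewrite le_eqVlt; apply/orP; left; apply/eqP.
    rewrite -[X in X * (nd / _)](sqr_sqrtr (ltW nR)); field.
    by rewrite gt_eqF//= gt_eqF.
  by rewrite le_eqVlt; apply/orP; left; apply/eqP; ring.
have sub : ~` G1 `&` G2 `<=` F.
  move=> w [/negP]; rewrite -ltNge => chiw G2w; rewrite /F/= -/r -/a -/y.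
  move: y0; case yE : y => [b| |] // _; last first.
    by rewrite [(a%:E + +oo)%E]addey// mulyy addey// leey.
  rewrite -[(a%:E + b%:E)%E]EFinD -EFinM -EFinD lee_fin -expr2.
  apply: oracle_inequality => //; first exact: noise.
  by rewrite -cE ltW.
have mF : measurable F.
  pose v z := fhat (f0 + z) - f0.
  have mv : measurable_fun setT (fun w => sqnormn (v (e w))).
    apply: measurable_sqnormn_lipschitz => // z1 z2.
    have -> : v z1 - v z2 = fhat (f0 + z1) - fhat (f0 + z2).
      by apply/colP => i; rewrite !mxE; ring.
    have -> : z1 - z2 = (f0 + z1) - (f0 + z2) by apply/colP => i; rewrite !mxE; ring.
    exact: (analysis_estimator_lipschitz (ltW lambda_gt0) fhat_argmin).
  rewrite -[F]setTI.
  apply: (emeasurable_fun_infty_c measurableT (f := fun w => (sqnormn (v (e w)))%:E)).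
  exact/measurable_EFinP.
have PF : (P (~` F) <= (expR (- x) + expR (- t))%:E)%E.
  apply: (@le_trans _ _ (P (G1 `|` ~` G2))).
    apply: le_measure; rewrite ?inE.
    - exact: measurableC.
    - by apply: measurableU => //; exact: measurableC.
    - move=> w Fw; have [|nG1] := pselect (G1 w); first by left.
      by right => G2w; apply: Fw; exact: sub.
  apply: le_trans (measureU2 _ mG1 (measurableC mG2)) _.
  by rewrite EFinD; exact: leeD.
have := probability_setC P (measurableC mF); rewrite setCK => ->.
have -> : (1 - expR (- x) - expR (- t))%:E = (1 - (expR (- x) + expR (- t))%:E)%E.
  by rewrite -EFinB opprD addrA.
exact: leeB.
Qed.
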